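(* Let $G=\mathcal{K}_{a_1,\dots,a_r}$ with $a_1\le\dots\le a_r$ be a complete $r$-partite graph on the vertex set $V=\bigsqcup_{l=1}^r V_l=[n]$. Let $K$ be a field and $J_G\subseteq S=K[x_1,\dots,x_n,y_1,\dots,y_n]$ the binomial edge ideal of $G$. Then $$\mathrm{v}(J_{\mathcal{K}_{a_1,\dots,a_r}})=\begin{cases}1, & \text{if } a_1=1,\\ 2=\operatorname{reg}(S/J_G), & \text{otherwise.}\end{cases}$$
   Context: $[n]=\{1,\dots,n\}$. The complete $r$-partite graph $\mathcal{K}_{a_1,\dots,a_r}$ on $V=\bigsqcup_{l=1}^r V_l$, with $|V_l|=a_l$, is the simple graph in which two vertices are adjacent if and only if they belong to different parts $V_l$. Binomial edge ideal: $J_G=(x_iy_j-x_jy_i \mid \{i,j\}\in E(G),\ i<j)\subseteq S$, with $S$ standard graded. v-number: for a homogeneous ideal $I$ of $S=\bigoplus_{d\ge 0}S_d$, $\mathrm{v}(I):=\min\{d\ge 0\mid \exists f\in S_d \text{ and } \mathfrak{p}\in\operatorname{Ass}(I)\text{ with } (I:f)=\mathfrak{p}\}$. Castelnuovo–Mumford regularity: if $b_{i,j}$ are the graded Betti numbers of $S/I$ as an $S$-module (i.e. the $i$-th module of the minimal graded free resolution is $\bigoplus_j S(-j)^{b_{i,j}}$), then $\operatorname{reg}(S/I)=\max\{j-i\mid b_{i,j}\ne 0\}$.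
   Formalization: The formal theorem assumes r ≥ 2, all parts non-empty, and a_r ≥ 2: if a_1=…=a_r=1 then G=K_n and J_G is prime, so v(J_G)=0 rather than 1; if r=1 then J_G=0 and v(J_G)=0. *)

(* Defs.v *)
(* Ideals are collective predicates ({pred R}), as in ring_quotient; the generated
   ideal is made boolean by classical reasoning (`[< _ >]). *)
From HB Require Import structures.
From mathcomp Require Import all_boot all_order all_algebra ring_quotient.
From mathcomp Require Import boolp.
From mathcomp.multinomials Require Import mpoly.

Set Implicit Arguments.
Unset Strict Implicit.
Unset Printing Implicit Defensive.

Import GRing.Theory.
Local Open Scope ring_scope.

Section Ideals.
Variable R : comNzRingType.

Definition ideal_gen (gs : seq R) : {pred R} :=
  fun f => `[< exists c : 'I_(size gs) -> R, f = \sum_(i < size gs) c i * gs`_i >].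

Definition colon (I : {pred R}) (f : R) : {pred R} := fun g => g * f \in I.

(* idealr_closed includes 1 \notin P *)
Definition prime_ideal (P : {pred R}) : Prop :=
  idealr_closed P /\ prime_idealr_closed P.

(* P is the annihilator of the class of some f in R / I *)
Definition ass_prime (I P : {pred R}) : Prop :=
  prime_ideal P /\ exists f : R, P =i colon I f.

End Ideals.

Section Graded.
Variables (K : fieldType) (N : nat).
Local Notation S := {mpoly K[N]}.

Definition v_attained (I : {pred S}) (d : nat) : Prop :=
  exists (f : S) (P : {pred S}),
    [/\ f \is d.-homog, ass_prime I P & colon I f =i P].

Definition is_vnumber (I : {pred S}) (d : nat) : Prop :=
  v_attained I d /\ forall d', v_attained I d' -> (d <= d')%N.

(* A sequence s of degrees stands for the graded free module
   F_s = (+)_a S(-s_a), whose elements are the row vectors 'rV[S]_(size s); the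
   a-th basis vector has degree s_a. A matrix M acts on rows by v |-> v *m M, and
   gives a degree-preserving map F_s -> F_t iff M a b is homogeneous of degree
   s_a - t_b (so zero if s_a < t_b). *)
Definition graded_mx (s t : seq nat) (M : 'M[S]_(size s, size t)) : Prop :=
  forall a b m, m \in msupp (M a b) -> (nth 0 t b + mdeg m = nth 0 s a)%N.

(* Natural shifts suffice: S / I lives in degrees >= 0, hence so do all the
   generators in its minimal resolution. *)
Record free_complex := FreeComplex {
  shifts : nat -> seq nat;
  (* a lift to S of the augmentation F_0 -> S / I *)
  augm : 'M[S]_(size (shifts 0), size [:: 0%N]);
  (* the differential F_(i+1) -> F_i *)
  diff : forall i, 'M[S]_(size (shifts i.+1), size (shifts i))
}.

Definition augm_map (F : free_complex) (v : 'rV[S]_(size (shifts F 0))) : S :=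
  (v *m augm F) ord0 ord0.

Record minimal_graded_resolution (I : {pred S}) (F : free_complex) : Prop := {
  augm_graded : graded_mx (augm F);
  diff_graded : forall i, graded_mx (diff F i);
  augm_surj : forall f : S, exists v : 'rV[S]_(size (shifts F 0)), f - augm_map v \in I;
  exact_augm : forall v : 'rV[S]_(size (shifts F 0)),
    augm_map v \in I <-> exists w, v = w *m diff F 0;
  exact_diff : forall i (v : 'rV[S]_(size (shifts F i.+1))),
    v *m diff F i = 0 <-> exists w, v = w *m diff F i.+1;
  (* the image of F_(i+1) lies in (variables) F_i *)
  diff_minimal : forall i a b, (diff F i a b)@_0%MM = 0
}.

(* The number b i j of summands S(-j) in the i-th module; it depends only on I,
   since the minimal graded free resolution is unique up to isomorphism. *)
Definition graded_betti (I : {pred S}) (b : nat -> nat -> nat) : Prop :=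
  exists F, minimal_graded_resolution I F /\
    forall i j, b i j = count_mem j (shifts F i).

(* reg (S / I) = m *)
Definition is_regularity (I : {pred S}) (m : int) : Prop :=
  exists b, [/\ graded_betti I b,
    exists i j : nat, b i j <> 0%N /\ m = j%:Z - i%:Z
    & forall i j : nat, b i j <> 0%N -> j%:Z - i%:Z <= m].

End Graded.

Section BinomialEdgeIdeal.
Variables (K : fieldType) (n : nat).

(* S = K[x_1..x_n, y_1..y_n] is {mpoly K[n + n]}, the x's coming first. *)
Definition xvar (i : 'I_n) : {mpoly K[n + n]} := 'X_(lshift n i).
Definition yvar (i : 'I_n) : {mpoly K[n + n]} := 'X_(rshift n i).

Definition binomial_edge_ideal (e : rel 'I_n) : {pred {mpoly K[n + n]}} :=
  ideal_gen [seq xvar p.1 * yvar p.2 - xvar p.2 * yvar p.1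
            | p : 'I_n * 'I_n in [pred p | e p.1 p.2 & (p.1 < p.2)%N]].

End BinomialEdgeIdeal.

Definition part_sizes (n r : nat) (V : 'I_r -> {set 'I_n}) (a : r.-tuple nat) :=
  [/\ \bigcup_(l < r) V l = [set: 'I_n],
      forall l m, l != m -> [disjoint V l & V m]
    & forall l, #|V l| = tnth a l].

Definition multipartite_rel (n r : nat) (V : 'I_r -> {set 'I_n}) : rel 'I_n :=
  fun i j => [exists l, exists m, [&& l != m, i \in V l & j \in V m]].

(* Main.v *)
(* Let f_ij = x_i y_j - x_j y_i, let J_K be the ideal of all the f_ij and P_l the
   ideal of the variables outside the part V_l.  For i, j in V_l the variables
   outside V_l multiply f_ij into J = J_G; this gives f - sum_l (f restricted to
   V_l) \in J for every f in J_K, hence J = J_K \cap (\bigcap_l P_l), where J_K is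
   prime, as the kernel of x_i -> t s_i, y_i -> s_i.
   The v-number is then read off: J : x_v = J_K when {v} is a part, and
   J : f_ij = P_l for i, j in V_l; conversely, if f is outside J_K and P_l with
   |V_l| > 1 then J : f contains some x_k f_ij but neither x_k nor f_ij.
   Regularity is controlled by the vanishing of Koszul homology in internal degree
   > m ("kreg").  It is 1 for S / J_K, by removing one vertex at a time: x_i is a
   nonzerodivisor, and y_i has annihilator (x_1, ..., x_n) modulo it.  The
   quotients of the filtration J_K \cap P_1 \cap ... \cap P_m are ideals of
   minors in the variables of one part, so that kreg is 2 for S / J.  Vanishing of
   Koszul homology passes to syzygies and bounds the degrees of their generators,
   so that degreewise finite-dimensionality yields a minimal resolution with
   shifts at most i + 2, without the Hilbert basis theorem.  The shift 4 occurs in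
   step 2: on a 4-cycle i k j m (i, j and k, m in two parts), the Koszul syzygy of
   f_ik and f_jm is not a combination of linear syzygies. *)
From HB Require Import structures.
Require Import Defs.
From mathcomp Require Import all_boot all_order all_algebra ring_quotient boolp ring.
From mathcomp.multinomials Require Import mpoly.

Set Implicit Arguments.
Unset Strict Implicit.
Unset Printing Implicit Defensive.

Import GRing.Theory.
Local Open Scope ring_scope.

(** * Koszul homology and regularity *)

Lemma pair_ext (A B : Type) (x y : A * B) : x.1 = y.1 -> x.2 = y.2 -> x = y.
Proof. by case: x y => ? ? [? ?] /= -> ->. Qed.

Section KoszulComplex.
Variables (R : comNzRingType) (l : nat -> R).

(* The Koszul complex of l_0, ..., l_(k-1) with coefficients in E, as an iterated
   mapping cone: (a, b) stands for a + b /\ e_k. *)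
Fixpoint koszul (E : lmodType R) k : lmodType R :=
  if k is k'.+1 then (koszul E k' * koszul E k')%type : lmodType R else E.

Fixpoint kdiff (E : lmodType R) k : koszul E k -> koszul E k :=
  match k with
  | 0 => fun _ => 0
  | k'.+1 => fun z => (kdiff z.1 + l k' *: z.2, - kdiff z.2)
  end.

(** Chains with coefficients in A form a predicate on the ambient [koszul E k], so a subquotient A /
    B is handled by two predicates, without submodule or quotient types. *)
Fixpoint kall (E : lmodType R) (A : E -> Prop) k : koszul E k -> Prop :=
  match k with
  | 0 => A
  | k'.+1 => fun z => kall A z.1 /\ kall A z.2
  end.

Fixpoint kmap (E E' : lmodType R) (f : E -> E') k : koszul E k -> koszul E' k :=
  match k with
  | 0 => f
  | k'.+1 => fun z => (kmap f z.1, kmap f z.2)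
  end.

(* Wedging with e_i, which makes the multiplication by l_i null-homotopic. *)
Fixpoint khom (E : lmodType R) i k : koszul E k -> koszul E k :=
  match k with
  | 0 => fun _ => 0
  | k'.+1 => fun z => if i == k' then (0, z.1) else (khom i z.1, - khom i z.2)
  end.

Fixpoint kinj (E : lmodType R) k (e : E) : koszul E k :=
  match k with 0 => e | k'.+1 => (kinj k' e, 0) end.

Fixpoint kproj (E : lmodType R) k : koszul E k -> E :=
  match k with 0 => fun z => z | k'.+1 => fun z => kproj z.1 end.

Section OneModule.
Variable E : lmodType R.

Lemma kdiff_linear k : linear (@kdiff E k).
Proof.
elim: k => [|k IHk] c z z' /=; first by rewrite scaler0 addr0.
rewrite !IHk; congr pair => /=; last by rewrite opprD scalerN.
by rewrite !scalerDr !scalerA addrACA (mulrC c).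
Qed.

HB.instance Definition _ k :=
  GRing.isLinear.Build R _ _ _ (@kdiff E k) (@kdiff_linear k).

Lemma kdiffD k : {morph @kdiff E k : z w / z + w}. Proof. exact: linearD. Qed.
Lemma kdiffB k : {morph @kdiff E k : z w / z - w}. Proof. exact: linearB. Qed.
Lemma kdiffN k : {morph @kdiff E k : z / - z}. Proof. exact: linearN. Qed.
Lemma kdiffZ k c : {morph @kdiff E k : z / c *: z}. Proof. exact: linearZ. Qed.

Lemma kdiffK k (z : koszul E k) : kdiff (kdiff z) = 0.
Proof.
elim: k z => [|k IHk] z //=.
by rewrite kdiffD kdiffZ kdiffN !IHk !oppr0 add0r scalerN subrr.
Qed.

Lemma khom_linear i k : linear (@khom E i k).
Proof.
elim: k => [|k IHk] c z z' /=; first by rewrite scaler0 addr0.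
case: eqP => _; congr pair => //=; rewrite ?scaler0 ?addr0 ?IHk //.
by rewrite opprD scalerN.
Qed.

HB.instance Definition _ i k :=
  GRing.isLinear.Build R _ _ _ (@khom E i k) (@khom_linear i k).

Lemma khomD i k : {morph @khom E i k : z w / z + w}. Proof. exact: linearD. Qed.
Lemma khomN i k : {morph @khom E i k : z / - z}. Proof. exact: linearN. Qed.
Lemma khomZ i k c : {morph @khom E i k : z / c *: z}. Proof. exact: linearZ. Qed.

(** Homotopy between multiplication by [l i] and zero: the minus signs in the second components of
    [kdiff] and [khom] make the mixed terms of each cone cancel. *)
Lemma khomP i k (z : koszul E k) :
  (i < k)%N -> l i *: z = kdiff (khom i z) + khom i (kdiff z).
Proof.
elim: k z => [|k IHk] z //=.
rewrite ltnS leq_eqVlt => lt_ik; apply: pair_ext => /=; case: eqP lt_ik => [->|_] /=.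
- by rewrite raddf0 add0r addr0.
- by move=> lt_ik; rewrite IHk // khomD khomZ addrACA scalerN addNr addr0.
- by rewrite addKr.
- by move=> lt_ik; rewrite IHk // kdiffN khomN !opprK.
Qed.

Section Subgroup.
Variable A : E -> Prop.
Hypotheses (A0 : A 0) (AB : forall u v, A u -> A v -> A (u - v)).

Lemma kall0 k : kall A (0 : koszul E k).
Proof. by elim: k => //= k IHk. Qed.

Lemma kallB k (z w : koszul E k) : kall A z -> kall A w -> kall A (z - w).
Proof. by elim: k z w => /= [|k IHk] z w; [exact: AB | case=> ? ? []; split; exact: IHk]. Qed.

Lemma kallN k (z : koszul E k) : kall A z -> kall A (- z).
Proof. by rewrite -[- z]add0r; apply: kallB; apply: kall0. Qed.

Lemma kallD k (z w : koszul E k) : kall A z -> kall A w -> kall A (z + w).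
Proof. by move=> Az Aw; rewrite -[w]opprK; apply: kallB => //; apply: kallN. Qed.

Lemma kall_hom i k (z : koszul E k) : kall A z -> kall A (khom i z).
Proof.
elim: k z => [|k IHk] z //= [Az1 Az2]; case: eqP => _ /=; split => //.
- exact: kall0.
- exact: IHk.
- by apply: kallN; apply: IHk.
Qed.

Lemma kall_inj k e : A e -> kall A (kinj k e).
Proof. by move=> Ae; elim: k => //= k IHk; split=> //; apply: kall0. Qed.

End Subgroup.

Lemma kall_sub (A B : E -> Prop) k (z : koszul E k) :
  (forall e, A e -> B e) -> kall A z -> kall B z.
Proof. by move=> sAB; elim: k z => /= [|k IHk] z; [exact: sAB | case; split; exact: IHk]. Qed.

Lemma kall_scale (A B : E -> Prop) c k (z : koszul E k) :
  (forall e, A e -> B (c *: e)) -> kall A z -> kall B (c *: z).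
Proof. by move=> cAB; elim: k z => /= [|k IHk] z; [exact: cAB | case; split; exact: IHk]. Qed.

Lemma kall_diff (A B : E -> Prop) k (z : koszul E k) :
    B 0 -> (forall u v, B u -> B v -> B (u - v)) ->
    (forall i e, A e -> B (l i *: e)) ->
  kall A z -> kall B (kdiff z).
Proof.
move=> B0 BB lAB; elim: k z => //= k IHk z [Az1 Az2]; split.
- by apply: kallD => //; [exact: IHk | apply: kall_scale Az2; exact: lAB].
- by apply: kallN => //; apply: IHk.
Qed.

Lemma kdiff_inj k e : kdiff (kinj k e : koszul E k) = 0.
Proof. by elim: k => //= k ->; rewrite scaler0 addr0 raddf0 oppr0. Qed.

Lemma kproj_linear k : linear (@kproj E k).
Proof. by elim: k => //= k IHk c z z'; rewrite IHk. Qed.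

HB.instance Definition _ k :=
  GRing.isLinear.Build R _ _ _ (@kproj E k) (@kproj_linear k).

Lemma kproj_inj k e : kproj (kinj k e : koszul E k) = e.
Proof. by elim: k => //= k ->. Qed.

Lemma kproj_all (A : E -> Prop) k (z : koszul E k) : kall A z -> A (kproj z).
Proof. by elim: k z => //= k IHk z [/IHk]. Qed.

Lemma kproj_diff (A : E -> Prop) k (z : koszul E k) :
  kall A z ->
  exists w : 'I_k -> E, (forall i, A (w i)) /\ kproj (kdiff z) = \sum_(i < k) l i *: w i.
Proof.
elim: k z => [|k IHk] z /=.
  by move=> _; exists (fun=> 0); split; [case | rewrite big_ord0].
(* The coefficient of the last index is the degree zero part of [z.2]; the others come from [w]. *)
case=> /IHk[w [Aw ew]] /kproj_all Az2; exists (fun i => oapp w (kproj z.2) (unlift ord_max i)).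
split; first by move=> i; case: unlift.
rewrite big_ord_recr /= unlift_none linearD linearZ /= ew; congr (_ + _).
apply: eq_bigr => i _; congr (_ *: _).
suff -> : widen_ord (leqnSn k) i = lift ord_max i by rewrite liftK.
by apply: val_inj; rewrite /= /bump leqNgt ltn_ord.
Qed.

End OneModule.

Section Maps.
Variables (E E' : lmodType R) (f : {linear E -> E'}).

Lemma kmap_linear k : linear (@kmap E E' f k).
Proof.
elim: k => [|k IHk] c z z' /=; first exact: linearP.
by rewrite !IHk.
Qed.

HB.instance Definition _ k :=
  GRing.isLinear.Build R _ _ _ (@kmap E E' f k) (@kmap_linear k).

Lemma kmapD k : {morph @kmap E E' f k : z w / z + w}. Proof. exact: linearD. Qed.
Lemma kmapB k : {morph @kmap E E' f k : z w / z - w}. Proof. exact: linearB. Qed.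
Lemma kmapN k : {morph @kmap E E' f k : z / - z}. Proof. exact: linearN. Qed.
Lemma kmapZ k c : {morph @kmap E E' f k : z / c *: z}. Proof. exact: linearZ. Qed.

Lemma kmap_diff k (z : koszul E k) : kmap f (kdiff z) = kdiff (kmap f z).
Proof.
elim: k z => [|k IHk] z /=; first exact: linear0.
by rewrite kmapD kmapN kmapZ !IHk.
Qed.

Lemma kall_map (A : E -> Prop) (B : E' -> Prop) k (z : koszul E k) :
  (forall e, A e -> B (f e)) -> kall A z -> kall B (kmap f z).
Proof. by move=> fAB; elim: k z => /= [|k IHk] z; [exact: fAB | case; split; exact: IHk]. Qed.

Lemma kall_lift (A B : E' -> Prop) (C : E -> Prop) k (z : koszul E' k) :
    (forall e, A e -> exists2 c, C c & B (e - f c)) -> kall A z ->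
  exists2 w, kall C w & kall B (z - kmap f w).
Proof.
move=> lift; elim: k z => /= [|k IHk] z; first exact: lift.
case=> /IHk[w1 Cw1 Bw1] /IHk[w2 Cw2 Bw2]; exists (w1, w2) => //.
Qed.

Lemma kall_reflect (A C : E -> Prop) (B : E' -> Prop) k (z : koszul E k) :
    (forall e, C e -> B (f e) -> A e) -> kall C z -> kall B (kmap f z) -> kall A z.
Proof.
by move=> rAB; elim: k z => /= [|k IHk] z; [exact: rAB | case=> ? ? []; split; exact: IHk].
Qed.

End Maps.

(** * Regularity of graded subquotients and its behaviour in exact sequences *)

Section Regularity.
Variable k : nat.

Record graded (E : lmodType R) (A : nat -> E -> Prop) : Prop := Graded {
  graded0 : forall t, A t 0;
  gradedB : forall t u v, A t u -> A t v -> A t (u - v);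
  gradedl : forall t i e, A t e -> A t.+1 (l i *: e)
}.

(* Vanishing of the Koszul homology of A / B in internal degree > m; over a
   polynomial ring this says reg (A / B) <= m. *)
Definition kreg (E : lmodType R) (A B : nat -> E -> Prop) (m : nat) : Prop :=
  forall t, (m <= t)%N -> forall z : koszul E k,
    kall (A t.+1) z -> kall (B t.+2) (kdiff z) ->
  exists2 w, kall (A t) w & kall (B t.+1) (z - kdiff w).

Section Basics.
Variable E : lmodType R.
Implicit Types A B C : nat -> E -> Prop.

Lemma kreg_leq A B m m' : (m <= m')%N -> kreg A B m -> kreg A B m'.
Proof. by move=> le_m rAB t /(leq_trans le_m); exact: rAB. Qed.

Lemma kreg_iff A B B' m :
  (forall t e, B t e <-> B' t e) -> kreg A B m -> kreg A B' m.
Proof.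
move=> eqB rAB t le_mt z Az Bdz; have [|w Aw Bzw] := rAB t le_mt z Az.
  by apply: kall_sub Bdz => e /eqB.
by exists w => //; apply: kall_sub Bzw => e /eqB.
Qed.

Lemma kall_gdiff A t (z : koszul E k) : graded A -> kall (A t) z -> kall (A t.+1) (kdiff z).
Proof.
by move=> gA; apply: kall_diff; [exact: graded0|exact: gradedB|move=> i e; exact: gradedl].
Qed.

Lemma kall_gB A t (z w : koszul E k) :
  graded A -> kall (A t) z -> kall (A t) w -> kall (A t) (z - w).
Proof. by move=> gA; apply: kallB => u v; exact: gradedB. Qed.

Lemma kall_gD A t (z w : koszul E k) :
  graded A -> kall (A t) z -> kall (A t) w -> kall (A t) (z + w).
Proof. by move=> gA; apply: kallD => [|u v]; [exact: graded0 | exact: gradedB]. Qed.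

Lemma kall_ghom A t i (z : koszul E k) : graded A -> kall (A t) z -> kall (A t) (khom i z).
Proof. by move=> gA; apply: kall_hom => [|u v]; [exact: graded0 | exact: gradedB]. Qed.

(** Only coefficients of degree at least 1 are tested by [kreg], and there A / B is zero. *)
Lemma kreg_trivial A B m :
  graded A -> (forall t e, A t.+1 e -> B t.+1 e) -> kreg A B m.
Proof.
move=> gA sAB t _ z Az _; exists 0; first by apply: kall0; exact: graded0.
by rewrite raddf0 subr0; apply: kall_sub Az => e; exact: sAB.
Qed.

(** The middle term of 0 -> A/B -> C/B -> C/A -> 0: a cycle is bounded first in C/A, then the
    remainder in A/B. *)
Lemma kreg_ext A B C m :
    graded C ->
    (forall t e, B t e -> A t e) -> (forall t e, A t e -> C t e) ->
  kreg A B m -> kreg C A m -> kreg C B m.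
Proof.
move=> gC sBA sAC rAB rCA t le_mt z Cz Bdz.
have [|w Cw Azw] := rCA t le_mt z Cz; first exact: kall_sub (sBA _) Bdz.
have [|w' Aw' Bzw] := rAB t le_mt _ Azw; first by rewrite kdiffB kdiffK subr0.
exists (w + w'); last by rewrite kdiffD opprD addrA.
by apply: kall_gD => //; exact: kall_sub (sAC _) Aw'.
Qed.

(** The connecting map of the same sequence: homology of A/B is controlled by that of C/B in the
    same degree and that of C/A one coefficient degree lower. *)
Lemma kreg_sub A B C m :
    graded A ->
    (forall t e, B t e -> A t e) -> (forall t e, A t e -> C t e) ->
  kreg C B m.+1 -> kreg C A m -> kreg A B m.+1.
Proof.
move=> gA sBA sAC rCB rCA [//|t] le_mt z Az Bdz.
have [|w Cw Bzw] := rCB t.+1 le_mt z _ Bdz; first exact: kall_sub (sAC _) Az.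
(* [w] bounds [z] in C/B, so it is a cycle of C/A; a boundary moves it into A without changing
   [kdiff w]. *)
have [|u Cu Awu] := rCA t le_mt w Cw.
  rewrite -[kdiff w](subKr z); apply: kall_gB => //.
  exact: kall_sub (sBA _) Bzw.
by exists (w - kdiff u) => //; rewrite kdiffB kdiffK subr0.
Qed.

(* If z is a cycle of A / B then z = kdiff w + l_i z' modulo B, because A / B' is
   acyclic; z' is a cycle since l_i is a nonzerodivisor, and then l_i z' is a
   boundary since l_i is null-homotopic. *)
Lemma kreg_regular A B B' m i : (i < k)%N ->
    graded A -> graded B ->
    (forall t e, B t e -> B' t e) ->
    (forall t e, A t e -> B t.+1 (l i *: e) -> B t e) ->
    (forall t e, B' t.+1 e -> exists2 q, A t q & B t.+1 (e - l i *: q)) ->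
  kreg A B' m -> kreg A B m.
Proof.
move=> lt_ik gA gB sBB' reg_l defB' rAB' t le_mt z Az Bdz.
have [|w Aw Bzw] := rAB' t le_mt z Az; first exact: kall_sub (sBB' _) Bdz.
have [z' Az' Bz'] := @kall_lift E E ( *:%R (l i)) _ _ _ k (z - kdiff w) (defB' t) Bzw.
have {}Bz' : kall (B t.+1) (z - kdiff w - l i *: z').
  suff <- : @kmap E E ( *:%R (l i)) k z' = l i *: z' by [].
  by elim: (k) (z') => //= k' IHk [a b] /=; rewrite !IHk.
have Bdz' : kall (B t.+1) (kdiff z').
  apply: (@kall_reflect E E ( *:%R (l i)) _ (A t.+1) (B t.+2)) => [e||].
  - exact: reg_l.
  - exact: kall_gdiff.
  have -> : @kmap E E ( *:%R (l i)) k (kdiff z') = kdiff z - kdiff (z - kdiff w - l i *: z').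
    rewrite !kdiffB kdiffK subr0 subKr linearZ /=.
    by elim: (k) (kdiff z') => //= k' IHk [a b] /=; rewrite !IHk.
  by apply: kall_gB => //; apply: kall_gdiff.
exists (w + khom i z').
  by apply: kall_gD => //; apply: kall_ghom.
have -> : z - kdiff (w + khom i z') = z - kdiff w - l i *: z' + khom i (kdiff z').
  by rewrite (khomP _ lt_ik) kdiffD !opprD !addrA subrK.
by apply: kall_gD => //; apply: kall_ghom.
Qed.

(* The degree zero part of the Koszul homology is the module of generators. *)
Lemma kreg_gen A m t e : graded A ->
    kreg A (fun _ e => e = 0) m -> (m <= t)%N -> A t.+1 e ->
  exists w : 'I_k -> E, (forall i, A t (w i)) /\ e = \sum_(i < k) l i *: w i.
Proof.
move=> gA rA le_mt Ae; have [||w Aw e_w] := rA t le_mt (kinj k e).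
- by apply: kall_inj => //; exact: graded0.
- by rewrite kdiff_inj; apply: kall0.
have [w' [Aw' ew']] := kproj_diff Aw; exists w'; split=> //.
have := kproj_all e_w; rewrite linearB /= kproj_inj ew' => /eqP.
by rewrite subr_eq0 => /eqP.
Qed.

End Basics.

Section Map.
Variables (E E' : lmodType R) (f : {linear E' -> E}).
Variables (A B : nat -> E -> Prop) (A' B' : nat -> E' -> Prop) (d m : nat).
Hypotheses (gB : graded B) (gA' : graded A').
Hypothesis fA : forall t e, A' t e -> A (t + d)%N (f e).
Hypothesis fB : forall t e, B' t e -> B (t + d)%N (f e).
Hypothesis f_surj : forall t e, A (t + d)%N e -> exists2 c, A' t c & B (t + d)%N (e - f c).
Hypothesis f_inj : forall t e, A' t e -> B (t + d)%N (f e) -> B' t e.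

(** [f] carries A'/B' isomorphically onto the part of A/B in degrees at least d, and
    [kreg A B (m + d)] sees only these degrees. *)
Lemma kreg_map : kreg A' B' m -> kreg A B (m + d).
Proof.
move=> rA t le_mt z Az Bdz.
have [t' def_t] : {t' | t = (t' + d)%N}.
  by exists (t - d)%N; rewrite subnK // (leq_trans (leq_addl _ _) le_mt).
rewrite {t}def_t leq_add2r -!addSn in le_mt Az Bdz *.
have [z1 Az1 Bz1] := kall_lift (f_surj (t := t'.+1)) Az.
have [||w Aw Bzw] := rA t' le_mt z1 => //.
  apply: (kall_reflect (f_inj (t := t'.+2))); first exact: kall_gdiff.
  rewrite -[kmap f _](subKr (kdiff z)) kmap_diff -kdiffB.
  by apply: kall_gB => //; rewrite !addSn; apply: kall_gdiff.
exists (kmap f w); first exact: kall_map (fA (t := t')) Aw.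
have -> : z - kdiff (kmap f w) = z - kmap f z1 + kmap f (z1 - kdiff w).
  by rewrite kmapB kmap_diff addrA subrK.
by apply: kall_gD => //; apply: kall_map (fB (t := t'.+1)) Bzw.
Qed.

Lemma kreg_comap : kreg A B (m + d) -> kreg A' B' m.
Proof.
move=> rA t le_mt z Az Bdz.
have [|||w Aw Bzw] := rA (t + d)%N _ (kmap f z); first by rewrite leq_add2r.
- by rewrite -addSn; apply: kall_map (fA (t := t.+1)) Az.
- by rewrite -kmap_diff -!addSn; apply: kall_map (fB (t := t.+2)) Bdz.
have [w1 Aw1 Bw1] := kall_lift (f_surj (t := t)) Aw.
exists w1 => //; apply: (kall_reflect (f_inj (t := t.+1))).
  by apply: kall_gB => //; exact: kall_gdiff.
have -> : kmap f (z - kdiff w1) = kmap f z - kdiff w + kdiff (w - kmap f w1).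
  by rewrite kmapB kdiffB kmap_diff addrA subrK.
by rewrite addSn; apply: kall_gD => //; apply: kall_gdiff.
Qed.

End Map.
End Regularity.
End KoszulComplex.

Local Notation piH d p := (pihomog (@mdeg _) d p).

(** * Homogeneous ideals of polynomial rings *)

Section PolyFacts.
Variables (n : nat) (R : comNzRingType).
Implicit Types p q : {mpoly R[n]}.

Lemma mpoly_ring_ind (P : {mpoly R[n]} -> Prop) :
    (forall c, P c%:MP) -> (forall i, P 'X_i) ->
    (forall p q, P p -> P q -> P (p + q)) -> (forall p q, P p -> P q -> P (p * q)) ->
  forall p, P p.
Proof.
move=> PC PX PD PM; elim/mpolyind => [|c m p _ _ Pp]; first by rewrite -mpolyC0.
apply: PD => //; rewrite -mul_mpolyC; apply: (PM) => //; rewrite mpolyXE_id.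
apply: big_ind => [|x y|i _]; [by rewrite -mpolyC1 | exact: PM |].
by elim: (m i) => [|k IHk]; rewrite ?expr0 -?mpolyC1 // exprS; apply: (PM).
Qed.

Lemma rmorph_mpoly_ext (S : comNzRingType) (f g : {rmorphism {mpoly R[n]} -> S}) :
  (forall c, f c%:MP = g c%:MP) -> (forall i, f 'X_i = g 'X_i) -> f =1 g.
Proof.
move=> eqC eqX; elim/mpoly_ring_ind => // p q; first by rewrite !rmorphD => -> ->.
by rewrite !rmorphM => -> ->.
Qed.

Lemma mpolyXU_neq0 (i : 'I_n) : 'X_i != 0 :> {mpoly R[n]}.
Proof.
apply/eqP => /(congr1 (mcoeff U_(i)%MM)).
by rewrite mcoeffXU eqxx mcoeff0 => /eqP; rewrite oner_eq0.
Qed.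

Lemma dhomog0E p : p \is 0.-homog -> p = (p@_0%MM)%:MP.
Proof.
move=> hp; apply/mpolyP => m; rewrite mcoeffC.
case: eqP => [->|/eqP nz_m]; first by rewrite mulr1.
by rewrite mulr0 (dhomog_nemf_coeff hp) //= mdeg_eq0.
Qed.

Lemma pihomog_sum p k :
  (msize p <= k)%N -> p = \sum_(d < k) piH d p.
Proof. exact: pihomog_partitionE. Qed.

Lemma pihomog_0 p : piH 0 p = (p@_0%MM)%:MP.
Proof.
rewrite (dhomog0E (pihomogP _ 0 p)); congr _%:MP.
have -> : p@_0%MM = \sum_(d < (msize p).+1) (piH d p)@_0%MM.
  by rewrite {1}(@pihomog_sum p (msize p).+1) // raddf_sum.
rewrite big_ord_recl /= [X in _ + X]big1 ?addr0 // => i _.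
apply: (dhomog_nemf_coeff (pihomogP _ _ _)).
by rewrite /= mdeg0.
Qed.

End PolyFacts.

Section HomogMorphism.
Variables (n n' : nat) (R R' : comNzRingType).
Variables (f : {mpoly R[n]} -> {mpoly R'[n']}) (e : nat).
Hypotheses (f0 : f 0 = 0) (fD : {morph f : p q / p + q}).
Hypothesis homog_f : forall d p, p \is d.-homog -> f p \is (d + e).-homog.

Lemma pihomog_morph d p : piH (d + e) (f p) = f (piH d p).
Proof.
rewrite {1}(@pihomog_sum _ _ p (maxn (msize p) d.+1)) ?leq_maxl // (big_morph f fD f0) raddf_sum /=.
have lt_d : (d < maxn (msize p) d.+1)%N by rewrite leq_max ltnSn orbT.
rewrite (bigD1 (Ordinal lt_d)) //= big1 ?addr0 => [|i ne_id].
  by rewrite pihomog_dE //; apply: homog_f; exact: pihomogP.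
apply: (@pihomog_ne0 _ _ _ (i + e)%N); first by rewrite eqn_add2r.
by apply: homog_f; exact: pihomogP.
Qed.

Lemma pihomog_morph_lt d p : (d < e)%N -> piH d (f p) = 0.
Proof.
move=> lt_de; rewrite [p](@pihomog_sum _ _ p (msize p)) // (big_morph f fD f0) raddf_sum /=.
rewrite big1 // => i _; apply: (@pihomog_ne0 _ _ _ (i + e)%N).
  by rewrite neq_ltn (leq_trans lt_de) ?leq_addl ?orbT.
by apply: homog_f; exact: pihomogP.
Qed.

End HomogMorphism.

Section RingMaps.
Variables (n n' : nat) (R R' : comNzRingType) (f : {rmorphism {mpoly R[n]} -> {mpoly R'[n']}}).
Hypothesis fC : forall c, f c%:MP \is 0.-homog.
Hypothesis fX : forall i, f 'X_i \is 1.-homog.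

Lemma dhomog_rmorph d p : p \is d.-homog -> f p \is d.-homog.
Proof.
have fM m : f 'X_[m] \is (mdeg m).-homog.
  rewrite mpolyXE_id rmorph_prod /= mdegE.
  elim/big_rec2: _ => [|i x d' _ fhomog]; first exact: dhomog1.
  apply: dhomogM fhomog; rewrite rmorphXn /= -[X in X.-homog]mul1n.
  exact: dhomogMn.
move=> /dhomogP hom_p; rewrite (mpolyE p) raddf_sum /=.
rewrite big_seq; apply: rpred_sum => m /hom_p def_d.
by rewrite -mul_mpolyC rmorphM /= -[d]add0n; apply: dhomogM => //; rewrite -def_d.
Qed.

End RingMaps.

Section Ideals.
Variables (K : fieldType) (N : nat).
Local Notation S := {mpoly K[N]}.
Implicit Types (p q u v : S) (I J X : S -> Prop).

Record is_ideal I : Prop := IsIdeal {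
  ideal0 : I 0;
  idealB : forall u v, I u -> I v -> I (u - v);
  idealM : forall c u, I u -> I (c * u)
}.

Record homog_ideal I : Prop := HomogIdeal {
  homog_idealW : is_ideal I;
  ideal_pihomog : forall d p, I p -> I (piH d p)
}.

Lemma idealN I u : is_ideal I -> I u -> I (- u).
Proof. by move=> iI Iu; rewrite -sub0r; apply: idealB => //; exact: ideal0. Qed.

Lemma idealD I u v : is_ideal I -> I u -> I v -> I (u + v).
Proof. by move=> iI Iu Iv; rewrite -[v]opprK; apply: idealB => //; exact: idealN. Qed.

Lemma ideal_sum (T : Type) (r : seq T) (P : pred T) I (F : T -> S) : is_ideal I ->
  (forall i, P i -> I (F i)) -> I (\sum_(i <- r | P i) F i).
Proof.
move=> iI IF; apply: big_ind => //; first exact: ideal0.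
by move=> u v; exact: idealD.
Qed.

Lemma idealT : homog_ideal (fun=> True).
Proof. by []. Qed.

Lemma idealI I J : homog_ideal I -> homog_ideal J -> homog_ideal (fun p => I p /\ J p).
Proof.
move=> [iI hI] [iJ hJ]; split; last by move=> d p [/hI ? /hJ].
split; first by split; apply: ideal0.
- by move=> u v [? ?] [? ?]; split; apply: idealB.
- by move=> c u [? ?]; split; apply: idealM.
Qed.

Lemma ideal_bigcap (T : Type) (I : T -> S -> Prop) (P : T -> Prop) :
  (forall i, P i -> homog_ideal (I i)) -> homog_ideal (fun p => forall i, P i -> I i p).
Proof.
move=> hI; split; last by move=> d p Ip i Pi; apply: ideal_pihomog (Ip i Pi); exact: hI.
split=> [i /hI[/ideal0]//|u v Iu Iv i Pi|c u Iu i Pi]; have [iI _] := hI i Pi.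
- by apply: idealB (Iu i Pi) (Iv i Pi).
- by apply: idealM (Iu i Pi).
Qed.

Lemma ideal_ker N' (R : comNzRingType) (f : {rmorphism S -> {mpoly R[N']}}) :
    (forall c, f c%:MP \is 0.-homog) -> (forall i, f 'X_i \is 1.-homog) ->
  homog_ideal (fun p => f p = 0).
Proof.
move=> fC fX; split=> [|d p fp0].
  split=> [|u v fu fv|c u fu]; first exact: raddf0.
  - by rewrite raddfB /= fu fv subr0.
  - by rewrite rmorphM /= fu mulr0.
have f_homog e q : q \is e.-homog -> f q \is (e + 0).-homog.
  by rewrite addn0; apply: dhomog_rmorph.
by have /= <- := pihomog_morph (rmorph0 f) (rmorphD f) f_homog d p; rewrite fp0 raddf0.
Qed.

Lemma dhomog_mul d e p q : q \is e.-homog -> p \is d.-homog -> q * p \is (d + e).-homog.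
Proof. by move=> hq hp; rewrite addnC; apply: dhomogM. Qed.

Lemma piH_mulr d e p q : q \is e.-homog -> piH (d + e) (p * q) = piH d p * q.
Proof.
move=> hq; rewrite !(mulrC _ q).
exact: (pihomog_morph (mulr0 q) (mulrDr q) (fun d p => dhomog_mul hq)).
Qed.

Lemma piH_mulr_lt d e p q : q \is e.-homog -> (d < e)%N -> piH d (p * q) = 0.
Proof.
move=> hq; rewrite (mulrC p).
exact: (pihomog_morph_lt (mulr0 q) (mulrDr q) (fun d p => dhomog_mul hq)).
Qed.

(** The ideal I + (x). *)
Definition adjoin I x p := exists q, I (p - q * x).

Lemma adjoin_ideal I x e : x \is e.-homog -> homog_ideal I -> homog_ideal (adjoin I x).
Proof.
move=> hx [iI hI]; split=> [|d p [q Ipq]].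
  split=> [|u v [q Iu] [r Iv]|c u [q Iu]].
  - by exists 0; rewrite mul0r subr0; exact: ideal0.
  - exists (q - r); have -> : u - v - (q - r) * x = (u - q * x) - (v - r * x) by ring.
    exact: idealB.
  - by exists (c * q); rewrite -mulrA -mulrBr; apply: idealM.
have [le_ed|lt_de] := leqP e d.
  by exists (piH (d - e) q); rewrite -(piH_mulr _ _ hx) subnK // -pihomogB; apply: hI.
by exists 0; rewrite mul0r subr0 -[piH d p]subr0 -(piH_mulr_lt q hx lt_de) -pihomogB; apply: hI.
Qed.

Lemma sub_adjoin I x p : I p -> adjoin I x p.
Proof. by exists 0; rewrite mul0r subr0. Qed.

Lemma mem_adjoin I x : is_ideal I -> adjoin I x x.
Proof. by move=> iI; exists 1; rewrite mul1r subrr; apply: ideal0. Qed.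

(** The ideal generated by a possibly infinite set; the inductive form gives induction over linear
    combinations. *)
Inductive ideal_span X : S -> Prop :=
| ideal_span0 : ideal_span X 0
| ideal_spanD c x p : X x -> ideal_span X p -> ideal_span X (c * x + p).

Lemma ideal_span_min X I : is_ideal I -> (forall x, X x -> I x) -> forall p, ideal_span X p -> I p.
Proof.
move=> iI sXI p; elim=> [|c x q Xx _ Iq]; first exact: ideal0.
by apply: idealD => //; apply: idealM => //; apply: sXI.
Qed.

Lemma ideal_span_ideal X : is_ideal (ideal_span X).
Proof.
have addg u v : ideal_span X u -> ideal_span X v -> ideal_span X (u + v).
  by elim=> [|c x p Xx _ IHp] gv; rewrite ?add0r // -addrA; apply: ideal_spanD => //; apply: IHp.
have mulg c u : ideal_span X u -> ideal_span X (c * u).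
  elim=> [|d x p Xx _ IHp]; first by rewrite mulr0; apply: ideal_span0.
  by rewrite mulrDr mulrA; apply: ideal_spanD.
split=> //; first exact: ideal_span0.
by move=> u v gu gv; apply: addg => //; rewrite -mulN1r; apply: mulg.
Qed.

Lemma mem_ideal_span X x : X x -> ideal_span X x.
Proof.
by move=> Xx; rewrite -[x]mul1r -[1 * x]addr0; apply: ideal_spanD => //; apply: ideal_span0.
Qed.

Lemma ideal_span_homog X :
  (forall x, X x -> exists e, x \is e.-homog) -> homog_ideal (ideal_span X).
Proof.
move=> hX; split=> [|d p]; first exact: ideal_span_ideal.
elim=> [|c x q Xx _ IHq]; first by rewrite pihomog0; exact: ideal_span0.
have [e hx] := hX x Xx; rewrite pihomogD; apply: idealD => //; first exact: ideal_span_ideal.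
have [le_ed|lt_de] := leqP e d; last by rewrite (piH_mulr_lt _ hx) //; exact: ideal_span0.
rewrite -(subnK le_ed) (piH_mulr _ _ hx); apply: idealM; first exact: ideal_span_ideal.
exact: mem_ideal_span.
Qed.

Definition gpart I (t : nat) : S^o -> Prop := fun p => p \is t.-homog /\ I p.

(** Indexed by natural numbers to fit [koszul]; the default 0 is homogeneous of every degree, so
    [graded] holds also for indices beyond the variables. *)
Definition var_nth (i : nat) : S := if insub i is Some j then 'X_j else 0.

Lemma var_nthE (j : 'I_N) : var_nth j = 'X_j.
Proof. by rewrite /var_nth insubT // => lt_j; congr 'X_ _; apply: val_inj. Qed.

Lemma dhomog_var (j : 'I_N) : 'X_j \is [in K[N], 1.-homog].
Proof. by rewrite dhomogX /= mdeg1. Qed.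

Lemma dhomog_var_nth i : var_nth i \is 1.-homog.
Proof. by rewrite /var_nth; case: insub => [j|]; [exact: dhomog_var | exact: dhomog0]. Qed.

Lemma gpart_graded I : is_ideal I -> graded var_nth (gpart I).
Proof.
move=> iI; split=> [t|t u v [hu Iu] [hv Iv]|t i u [hu Iu]].
- by split; [exact: dhomog0 | exact: ideal0].
- by split; [exact: rpredB | exact: idealB].
- by split; [rewrite -add1n; apply: dhomogM => //; exact: dhomog_var_nth | exact: idealM].
Qed.

Lemma homog_split I x t p : homog_ideal I -> x \is 1.-homog -> p \is t.+1.-homog ->
  adjoin I x p -> exists2 q, q \is t.-homog & gpart I t.+1 (p - x * q).
Proof.
move=> [iI hI] hx hp [q Ipq]; exists (piH t q); first exact: pihomogP.
split; first by apply: rpredB => //; rewrite -add1n; apply: dhomogM => //; exact: pihomogP.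
by rewrite mulrC -(piH_mulr _ _ hx) addn1 -[p in p - _](pihomog_dE hp) -pihomogB; apply: hI.
Qed.

(** Setting the variables of T to zero: its kernel is the ideal they generate, so membership in that
    ideal becomes an equation in a domain. *)
Definition kill (T : {set 'I_N}) : S -> S :=
  mmap (@mpolyC N K) (fun i => if i \in T then 0 else 'X_i).

HB.instance Definition _ T := GRing.RMorphism.copy (kill T) (kill T).

Lemma killC T c : kill T c%:MP = c%:MP. Proof. exact: mmapC. Qed.

Lemma killX T i : kill T 'X_i = if i \in T then 0 else 'X_i.
Proof. by rewrite /kill mmapX mmap1U. Qed.

Lemma ker_kill T : homog_ideal (fun p => kill T p = 0).
Proof.
apply: ideal_ker => [c|i] /=.
  by rewrite killC dhomogE msuppC; case: ifP => //=; rewrite mdeg0.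
by rewrite killX; case: ifP => _; [exact: dhomog0 | exact: dhomog_var].
Qed.

Definition vars_in (T : {set 'I_N}) (x : S) := exists2 i, i \in T & x = 'X_i.

Lemma kill_subr T p : ideal_span (vars_in T) (p - kill T p).
Proof.
have iG := ideal_span_ideal (vars_in T).
elim/mpoly_ring_ind: p => [c|i|p q gp gq|p q gp gq].
- by rewrite killC subrr; apply: ideal_span0.
- rewrite killX; case: ifP => Ti; last by rewrite subrr; apply: ideal_span0.
  by rewrite subr0; apply: mem_ideal_span; exists i.
- by rewrite rmorphD opprD addrACA; apply: idealD.
- rewrite rmorphM /=.
  have -> : p * q - kill T p * kill T q = q * (p - kill T p) + kill T p * (q - kill T q) by ring.
  by apply: idealD => //; apply: idealM.
Qed.

Lemma ker_killP T p : kill T p = 0 <-> ideal_span (vars_in T) p.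
Proof.
split=> [kp0|]; first by rewrite -[p]subr0 -kp0; apply: kill_subr.
apply: (@ideal_span_min _ (fun p => kill T p = 0)); first by case: (ker_kill T).
by move=> _ [i Ti ->]; rewrite killX Ti.
Qed.

Lemma kill_adjoin T i p : kill (i |: T) p = 0 -> adjoin (fun p => kill T p = 0) 'X_i p.
Proof.
have iA := adjoin_ideal (dhomog_var i) (ker_kill T).
move=> /ker_killP; apply: ideal_span_min; first by case: iA.
move=> _ [j /setU1P[->|Tj] ->]; first by apply: mem_adjoin; case: (ker_kill T).
by apply: sub_adjoin; rewrite killX Tj.
Qed.

Lemma killT p : kill setT p = (p@_0%MM)%:MP.
Proof.
apply: (@rmorph_mpoly_ext N K S (kill setT) (@mpolyC N K \o mcoeff 0%MM)) => [c|i] /=.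
  by rewrite killC mpolyCK.
rewrite killX inE mcoeffX; case: eqP => [/(congr1 mdeg)|_]; last by rewrite mpolyC0.
by rewrite mdeg1 mdeg0.
Qed.

Lemma kill_set0 p : kill set0 p = p.
Proof.
by apply: (@rmorph_mpoly_ext N K S (kill set0) idfun) => [c|i] /=; rewrite (killC, killX) ?inE.
Qed.

(** Induction on the number of surviving variables: a variable outside T is a nonzerodivisor modulo
    those of T, and it is added to T. When all variables are killed, the quotient is concentrated in
    degree 0. *)
Lemma kreg_kill T : kreg var_nth N (gpart (fun=> True)) (gpart (fun p => kill T p = 0)) 0.
Proof.
have [k] := ubnP #|~: T|; elim: k T => // k IHk T lt_k.
have gA := gpart_graded (homog_idealW idealT).
have [T0|[i]] := set_0Vmem (~: T); last rewrite inE => notTi.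
  apply: kreg_trivial => // t e [he _]; split=> //.
  rewrite -[T]setCK T0 setC0 killT (dhomog_nemf_coeff he) ?mpolyC0 //.
  by rewrite /= mdeg0.
have gB := gpart_graded (homog_idealW (ker_kill T)).
apply: (@kreg_regular _ _ _ _ _ _ (gpart (fun p => kill (i |: T) p = 0)) _ i) => //.
- move=> t e [he ke]; split=> //.
  apply/ker_killP; apply: ideal_span_min (iffLR (ker_killP _ _) ke); first exact: ideal_span_ideal.
  by move=> _ [j Tj ->]; apply: mem_ideal_span; exists j => //; rewrite setU1r.
- move=> t e [he _] [_ kle]; split=> //; apply/eqP.
  move/eqP: kle; rewrite /= /GRing.scale /= rmorphM /= var_nthE killX (negPf notTi).
  by rewrite mulf_eq0 (negPf (mpolyXU_neq0 _ _)).
- move=> t e [he /kill_adjoin ae].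
  have [q hq Bq] := homog_split (ker_kill T) (dhomog_var i) he ae.
  by exists q => //; rewrite var_nthE.
- apply: IHk; apply: leq_trans (ltnSE lt_k); rewrite setCU; apply: proper_card.
  apply/properP; split; first by rewrite subsetIr.
  by exists i; rewrite ?inE // eqxx.
Qed.

End Ideals.

(** * Graded free modules and minimal resolutions *)

Section GradedFree.
Variables (K : fieldType) (N : nat).
Local Notation S := {mpoly K[N]}.

(* A degree function sh : 'I_p -> nat stands for the graded free module
   (+)_b S(-sh b), with elements the row vectors 'rV[S]_p. *)
Definition fhomog p (sh : 'I_p -> nat) (t : nat) (v : 'rV[S]_p) : Prop :=
  forall b m, m \in msupp (v 0 b) -> (sh b + mdeg m = t)%N.

(** The test matters: for [t < sh b] the truncated difference is 0 and would keep the constant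
    term. *)
Definition fcomp p (sh : 'I_p -> nat) (t : nat) (v : 'rV[S]_p) : 'rV[S]_p :=
  \row_b (if (sh b <= t)%N then piH (t - sh b) (v 0 b) else 0).

Definition fgraded_mx p q (sh : 'I_p -> nat) (sh' : 'I_q -> nat) (G : 'M[S]_(p, q)) : Prop :=
  forall a b m, m \in msupp (G a b) -> (sh' b + mdeg m = sh a)%N.

Section OneModule.
Variables (p : nat) (sh : 'I_p -> nat).
Implicit Types (v w : 'rV[S]_p) (t : nat).
Local Notation fhomog := (fhomog sh).
Local Notation fcomp := (fcomp sh).

Lemma fhomogP t v : fhomog t v <->
  forall b, if (sh b <= t)%N then is_true (v 0 b \is (t - sh b).-homog) else v 0 b = 0.
Proof.
split=> hv b; last move=> m m_in.
  case: leqP => [le_t|lt_t].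
    by apply/dhomogP => m /hv <-; rewrite addKn.
  apply/mpolyP => m; rewrite mcoeff0; apply: contraTeq lt_t.
  by rewrite -mcoeff_msupp => /hv <-; rewrite -leqNgt leq_addr.
have := hv b; case: leqP => [le_t /dhomogP/(_ m m_in) ->|_ v0]; first by rewrite subnKC.
by rewrite v0 msupp0 in m_in.
Qed.

Lemma fhomog0 t : fhomog t 0.
Proof. by move=> b m; rewrite mxE msupp0. Qed.

Lemma fhomogB t v w : fhomog t v -> fhomog t w -> fhomog t (v - w).
Proof.
move=> /fhomogP hv /fhomogP hw; apply/fhomogP => b; have := hv b; have := hw b; rewrite !mxE.
by case: leqP => _ => [hwb hvb|-> ->]; [exact: rpredB | rewrite subr0].
Qed.

Lemma fhomogZ t e c v : c \is e.-homog -> fhomog t v -> fhomog (e + t) (c *: v).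
Proof.
move=> hc /fhomogP hv; apply/fhomogP => b; rewrite !mxE; have := hv b.
case: leqP => [le_t hvb|_ ->]; last by rewrite mulr0; case: ifP => // _; exact: dhomog0.
by rewrite (leq_trans le_t) ?leq_addl // -addnBA //; apply: dhomogM.
Qed.

Lemma fcomp_homog t v : fhomog t (fcomp t v).
Proof. by apply/fhomogP => b; rewrite mxE; case: leqP => // _; exact: pihomogP. Qed.

Lemma fcomp_id t v : fhomog t v -> fcomp t v = v.
Proof.
move=> /fhomogP hv; apply/rowP => b; rewrite mxE; have := hv b.
by case: leqP => [_ /pihomog_dE|_ ->].
Qed.

Lemma fcomp_sum v : exists T, v = \sum_(t < T) fcomp t v.
Proof.
pose T := \max_b (sh b + msize (v 0%R b))%N; exists T; apply/rowP => b; rewrite summxE.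
have le_T : (sh b + msize (v 0%R b) <= T)%N by apply: leq_bigmax.
rewrite (@pihomog_sum _ _ (v 0 b) (T - sh b)); last first.
  by rewrite leq_subRL // (leq_trans _ le_T) ?leq_addr.
rewrite -(big_mkord xpredT (fun d => piH d (v 0 b))).
rewrite -(big_mkord xpredT (fun t => fcomp t v 0 b)).
rewrite [RHS](@big_cat_nat _ _ _ (sh b)) //=; last first.
  by apply: leq_trans le_T; rewrite leq_addr.
rewrite [X in _ = X + _]big_nat [X in _ = X + _]big1 ?add0r => [|t /andP[_ lt_t]]; last first.
  by rewrite mxE leqNgt lt_t.
rewrite -{2}[sh b]add0n big_addn; apply: eq_bigr => t _.
by rewrite mxE leq_addl addnK.
Qed.

End OneModule.

(** The entries [G a b] are homogeneous of degree [sh a - sh' b]; terms for which a difference of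
    degrees would be negative vanish on both sides. *)
Lemma fcompM p q (sh : 'I_p -> nat) (sh' : 'I_q -> nat) (G : 'M[S]_(p, q)) t (w : 'rV[S]_p) :
  fgraded_mx sh sh' G -> fcomp sh' t (w *m G) = fcomp sh t w *m G.
Proof.
move=> gG; apply/rowP => b; rewrite !mxE; case: leqP => [le_t|lt_t]; last first.
  rewrite big1 // => a _; rewrite mxE; case: leqP => [le_at|_]; last by rewrite mul0r.
  suff -> : G a b = 0 by rewrite mulr0.
  apply/mpolyP => m; rewrite mcoeff0; apply: contraTeq lt_t.
  rewrite -mcoeff_msupp -leqNgt => /gG def_a; rewrite -def_a in le_at.
  by apply: leq_trans le_at; rewrite leq_addr.
rewrite raddf_sum; apply: eq_bigr => a _ /=; rewrite !mxE.
have [le_ba|lt_ab] := leqP (sh' b) (sh a); last first.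
  suff -> : G a b = 0 by rewrite !mulr0 pihomog0.
  apply/mpolyP => m; rewrite mcoeff0; apply: contraTeq lt_ab.
  by rewrite -mcoeff_msupp -leqNgt => /gG <-; rewrite leq_addr.
have hG : G a b \is (sh a - sh' b).-homog by apply/dhomogP => m /gG <-; rewrite addKn.
case: leqP => [le_at|lt_ta].
  by rewrite -(piH_mulr _ _ hG) addnBA // subnK.
by rewrite mul0r; apply: (piH_mulr_lt _ hG); rewrite ltn_sub2r // (leq_ltn_trans le_t).
Qed.

Lemma fgraded_mx_homog p q (sh : 'I_p -> nat) (sh' : 'I_q -> nat) (G : 'M[S]_(p, q)) t
    (w : 'rV[S]_p) :
  fgraded_mx sh sh' G -> fhomog sh t w -> fhomog sh' t (w *m G).
Proof. by move=> gG /fcomp_id <-; rewrite -(fcompM _ _ gG); apply: fcomp_homog. Qed.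

Record submod p (sh : 'I_p -> nat) (Z : 'rV[S]_p -> Prop) : Prop := Submod {
  submod0 : Z 0;
  submodB : forall u v, Z u -> Z v -> Z (u - v);
  submodZ : forall c u, Z u -> Z (c *: u);
  submod_fcomp : forall t u, Z u -> Z (fcomp sh t u)
}.

Definition fpart p (sh : 'I_p -> nat) (Z : 'rV[S]_p -> Prop) (t : nat) (v : 'rV[S]_p) :=
  fhomog sh t v /\ Z v.

(** With it [kreg] speaks of a submodule rather than of a quotient. *)
Definition fzero p (t : nat) (v : 'rV[S]_p) := v = 0.

Section Submodules.
Variables (p : nat) (sh : 'I_p -> nat).

Lemma fpart_graded Z : submod sh Z -> graded (var_nth K N) (fpart sh Z).
Proof.
move=> sZ; split=> [t|t u v [hu Zu] [hv Zv]|t i u [hu Zu]].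
- by split; [exact: fhomog0 | exact: submod0 sZ].
- by split; [exact: fhomogB | exact: (submodB sZ)].
- by split; [rewrite -add1n; apply: fhomogZ => //; exact: dhomog_var_nth | exact: (submodZ sZ)].
Qed.

Lemma fzero_graded : graded (var_nth K N) (@fzero p).
Proof.
rewrite /fzero; split=> // [t u v -> ->|t i u ->]; first exact: subr0.
exact: scaler0.
Qed.

Lemma submod_mulmx Z q (w : 'rV[S]_q) (G : 'M[S]_(q, p)) : submod sh Z ->
  (forall i, Z (row i G)) -> Z (w *m G).
Proof.
move=> sZ ZG; rewrite mulmx_sum_row; apply: big_ind => [|x y Zx Zy|i _].
- exact: submod0 sZ.
- rewrite -[y]opprK; apply: (submodB sZ) => //; rewrite -sub0r; apply: (submodB sZ) => //.
  exact: submod0 sZ.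
- exact: (submodZ sZ).
Qed.

Lemma submodT : submod sh (fun=> True). Proof. by []. Qed.

Lemma submod_ker q (sh' : 'I_q -> nat) (G : 'M[S]_(p, q)) :
  fgraded_mx sh sh' G -> submod sh (fun w => w *m G = 0).
Proof.
move=> gG; split=> [|u v Gu Gv|c u Gu|t u Gu]; first exact: mul0mx.
- by rewrite mulmxBl Gu Gv subr0.
- by rewrite -scalemxAl Gu scaler0.
- by rewrite -(fcompM _ _ gG) Gu fcomp_id //; exact: fhomog0.
Qed.

Definition inject (k : 'I_p) (c : S^o) : 'rV[S]_p := \row_b (if b == k then c else 0).

Lemma inject_linear k : linear (inject k).
Proof.
move=> a u v; apply/rowP => b; rewrite !mxE; case: eqP => // _.
by rewrite mulr0 addr0.
Qed.

HB.instance Definition _ k := GRing.isLinear.Build S _ _ _ (inject k) (inject_linear k).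

(** Filtration by the vectors supported on the first k coordinates; each quotient is a copy of S
    shifted by the degree of one basis vector. *)
Lemma kreg_free D : (forall b, sh b <= D)%N ->
  kreg (var_nth K N) N (fpart sh (fun=> True)) (@fzero p) D.
Proof.
move=> le_D; pose A k := fpart sh (fun v => forall b : 'I_p, (k <= b)%N -> v 0 b = 0).
have gA k : graded (var_nth K N) (A k).
  apply: fpart_graded; split=> [b _|u v Au Av b le_kb|c u Au b le_kb|t u Au b le_kb];
    rewrite mxE ?mxE.
  - by [].
  - by rewrite Au // Av // subr0.
  - by rewrite Au // mulr0.
  - by case: ifP => // _; rewrite Au // pihomog0.
suff: forall k, (k <= p)%N -> kreg (var_nth K N) N (A k) (@fzero p) D.
  move/(_ p (leqnn p)) => rA t le_t z Tz Bdz; have [||w Aw Bw] := rA t le_t z => //.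
    by apply: kall_sub Tz => v [hv _]; split=> // b; rewrite leqNgt ltn_ord.
  by exists w => //; apply: kall_sub Aw => v [].
elim=> [_|k IHk lt_k].
  apply: kreg_trivial => // t v [_ v0].
  by apply/rowP => b; rewrite mxE v0.
apply: (@kreg_ext _ _ _ _ (A k) _ _ _ (gA k.+1)).
- by move=> t v ->; exact: (graded0 (gA k)).
- by move=> t v [hv v0]; split=> // b le_kb; apply: v0; exact: ltnW.
- by apply: IHk; exact: ltnW.
pose k' := Ordinal lt_k; apply: (@kreg_leq _ _ _ _ _ _ (0 + sh k')%N); first by rewrite add0n.
have gS := gpart_graded (homog_idealW (@idealT K N)).
(* [kill set0] is the identity, so its kernel is zero and [kreg_kill] bounds the regularity of S
   itself. *)
apply: (@kreg_map _ _ _ _ _ (inject k') _ _ _ (gpart (fun c => kill set0 c = 0)) _ _ (gA k) gS);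
  last exact: kreg_kill.
- move=> t c [hc _]; split.
    apply/fhomogP => b; rewrite mxE; case: eqP => [->|_]; first by rewrite leq_addl addnK.
    by case: ifP => // _; exact: dhomog0.
  by move=> b lt_kb; rewrite mxE ifN // neq_ltn lt_kb orbT.
- move=> t c [_ kc0]; rewrite kill_set0 in kc0; rewrite kc0 raddf0; apply: graded0; exact: gA.
- move=> t v [hv v0]; exists (v 0 k').
    split=> //; have := iffLR (fhomogP _ _ _) hv k'; by rewrite leq_addl addnK.
  split; last first.
    move=> b le_kb; rewrite !mxE; case: eqP => [->|ne_bk]; first exact: subrr.
    rewrite subr0; apply: v0; rewrite ltn_neqAle le_kb andbT.
    by apply/eqP => eq_kb; apply: ne_bk; apply: val_inj.
  apply: fhomogB => //; apply/fhomogP => b; rewrite mxE; case: eqP => [->|_].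
    by have := iffLR (fhomogP _ _ _) hv k'.
  by case: ifP => // _; exact: dhomog0.
- move=> t c [hc _] [_ /(_ k' (leqnn k))]; rewrite mxE eqxx => ->.
  by split; [exact: dhomog0 | exact: raddf0].
Qed.

End Submodules.
End GradedFree.

(** * Finite minimal generating families of graded submodules *)

Section Generators.
Variables (K : fieldType) (N : nat).
Local Notation S := {mpoly K[N]}.

Section Step.
Variables (p : nat) (sh : 'I_p -> nat) (Z : 'rV[S]_p -> Prop) (D : nat).
Hypothesis sZ : submod sh Z.
Hypothesis Z_reg : kreg (var_nth K N) N (fpart sh Z) (@fzero K N p) D.

(** Coefficients at monomials of degree at most t; since shifts are nonnegative, they determine a
    vector of degree t. *)
Definition coords (t : nat) (v : 'rV[S]_p) : 'rV[K]_#|{: 'I_p * 'X_{1..N < t.+1}}| :=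
  \row_j (let x : 'I_p * 'X_{1..N < t.+1} := enum_val j in (v 0 x.1)@_x.2).

Lemma coords_inj t u v : fhomog sh t u -> fhomog sh t v -> coords t u = coords t v -> u = v.
Proof.
move=> hu hv /rowP eq_uv; apply/rowP => b; apply/mpolyP => m.
have [le_m|lt_m] := leqP (mdeg m) t.
  have := eq_uv (enum_rank (b, BMultinom (le_m : (mdeg m < t.+1)%N))).
  by rewrite !mxE enum_rankK.
have co0 w : fhomog sh t w -> (w 0 b)@_m = 0.
  move=> hw; apply: contraTeq lt_m; rewrite -mcoeff_msupp => /hw <-.
  by rewrite -leqNgt leq_addl.
by rewrite !co0.
Qed.

Lemma coords_mul t q (c : 'rV[K]_q) (G : 'M[S]_(q, p)) :
  coords t (map_mx (@mpolyC N K) c *m G) = c *m \matrix_i coords t (row i G).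
Proof.
apply/rowP => j; rewrite !mxE /= mxE raddf_sum; apply: eq_bigr => i _ /=.
by rewrite !mxE mcoeffCM /= mxE.
Qed.

(* The coordinates of elements of the degree t part of Z form a subspace of a
   finite dimensional space: take a family of maximal rank. *)
Lemma finite_span t : exists q (G : 'M[S]_(q, p)), (forall i, fpart sh Z t (row i G)) /\
  forall v, fpart sh Z t v -> exists w, v = w *m G.
Proof.
pose P k := `[< exists q (G : 'M[S]_(q, p)), (forall i, fpart sh Z t (row i G)) /\
  \rank (\matrix_i coords t (row i G)) = k >].
have exP : exists k, P k.
  exists 0%N; apply/asboolP; exists 0%N, 0; split=> [[]//|].
  by rewrite [X in \rank X]flatmx0 mxrank0.
have ubP k : P k -> (k <= #|{: 'I_p * 'X_{1..N < t.+1}}|)%N.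
  by move=> /asboolP[q [G [_ <-]]]; exact: rank_leq_col.
case: (ex_maxnP exP ubP) => k /asboolP[q [G [ZG rkG]]] max_k.
exists q, G; split=> // v Zv.
have hG w : fhomog sh t (map_mx (@mpolyC N K) w *m G).
  rewrite mulmx_sum_row; apply: big_ind => [|x y hx hy|i _]; first exact: fhomog0.
    rewrite -[y]opprK; apply: fhomogB => //; rewrite -sub0r; apply: fhomogB => //; exact: fhomog0.
  rewrite mxE -[t]add0n; apply: fhomogZ; last by case: (ZG i).
  by rewrite dhomogE msuppC; case: ifP => //=; rewrite mdeg0.
(* Appending v cannot raise the maximal rank, so its coordinates are a combination of those of the
   rows of G. *)
pose G1 := col_mx G v.
have ZG1 i : fpart sh Z t (row i G1).
  rewrite -(splitK i); case: (split i) => j /=; first by rewrite rowKu.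
  by rewrite rowKd row_id.
have sub_v : (coords t v <= \matrix_i coords t (row i G))%MS.
  have sG : (\matrix_i coords t (row i G) <= \matrix_i coords t (row i G1))%MS.
    apply/row_subP => i; rewrite rowK -(rowKu i G v).
    by apply: eq_row_sub (lshift 1 i) _; rewrite rowK.
  have /eqP eq_rk : \rank (\matrix_i coords t (row i G)) = \rank (\matrix_i coords t (row i G1)).
    apply/eqP; rewrite eqn_leq mxrankS //= rkG; apply: max_k.
    by apply/asboolP; exists (q + 1)%N, G1.
  apply: (submx_trans _ (_ : \matrix_i coords t (row i G1) <= _)%MS); last first.
    by rewrite -(mxrank_leqif_sup sG).
  by apply: eq_row_sub (rshift q ord0) _; rewrite rowK rowKd row_id.
have [c def_c] := submxP sub_v; exists (map_mx (@mpolyC N K) c).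
by apply: (@coords_inj t) => //; [case: Zv | rewrite def_c coords_mul].
Qed.

Lemma gen_family T : exists q (d : 'I_q -> nat) (G : 'M[S]_(q, p)),
  [/\ forall i, (d i <= T)%N /\ Z (row i G), fgraded_mx d sh G
    & forall t v, (t <= T)%N -> fpart sh Z t v -> exists w, v = w *m G].
Proof.
elim: T => [|T [q1 [d1 [G1 [ZG1 gG1 spanG1]]]]].
  have [q [G [ZG spanG]]] := finite_span 0; exists q, (fun=> 0%N), G; split.
  - by move=> i; case: (ZG i).
  - by move=> a b m m_in; have [hG _] := ZG a; apply: (hG b); rewrite mxE.
  - by move=> t v; rewrite leqn0 => /eqP ->; exact: spanG.
have [q2 [G2 [ZG2 spanG2]]] := finite_span T.+1.
exists (q1 + q2)%N, (fun i => if split i is inl j then d1 j else T.+1), (col_mx G1 G2); split.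
- move=> i; rewrite -(splitK i); case: (split i) => j; rewrite unsplitK /=.
    by rewrite rowKu; case: (ZG1 j) => le_d ?; split=> //; exact: leqW.
  by rewrite rowKd; case: (ZG2 j).
- move=> a b m; rewrite -(splitK a); case: (split a) => j; rewrite unsplitK /=.
    by rewrite col_mxEu; exact: gG1.
  by rewrite col_mxEd => m_in; have [hG _] := ZG2 j; apply: (hG b); rewrite mxE.
- move=> t v; rewrite leq_eqVlt => /orP[/eqP ->|]; last rewrite ltnS => le_t.
    by move/spanG2 => [w ->]; exists (row_mx 0 w); rewrite mul_row_col mul0mx add0r.
  by move/(spanG1 _ _ le_t) => [w ->]; exists (row_mx w 0); rewrite mul_row_col mul0mx addr0.
Qed.

Definition generating q (d : 'I_q -> nat) (G : 'M[S]_(q, p)) :=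
  [/\ forall i, (d i <= D)%N /\ Z (row i G), fgraded_mx d sh G
    & forall v, Z v -> exists w, v = w *m G].

(** By [kreg_gen] an element of degree above D is a combination of variables times elements of Z one
    degree lower, so the degrees up to D suffice. *)
Lemma generating_exists : exists q (d : 'I_q -> nat) (G : 'M[S]_(q, p)), generating d G.
Proof.
have [q [d [G [ZG gG spanG]]]] := gen_family D; exists q, d, G; split=> //.
have span_hom t v : fpart sh Z t v -> exists w, v = w *m G.
  elim: t v => [|t IHt] v Zv; first exact: spanG Zv.
  have [le_t|lt_t] := leqP t.+1 D; first exact: spanG Zv.
  have [w [Zw ->]] := kreg_gen (fpart_graded sZ) Z_reg (ltnSE lt_t) Zv.
  have /fin_all_exists[x def_x] i : exists x, w i = x *m G by exact: IHt.
  exists (\sum_(i < N) var_nth K N i *: x i); rewrite mulmx_suml; apply: eq_bigr => i _.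
  by rewrite -scalemxAl -def_x.
move=> v Zv; have [T ->] := fcomp_sum sh v.
have /fin_all_exists[x def_x] (t : 'I_T) : exists x, fcomp sh t v = x *m G.
  by apply: (span_hom t); split; [exact: fcomp_homog | exact: (submod_fcomp sZ)].
by exists (\sum_t x t); rewrite mulmx_suml; apply: eq_bigr => t _.
Qed.

(* A relation with a unit coefficient makes a generator redundant, so a
   homogeneous generating family of least cardinality is minimal. *)
Lemma generating_drop q (d : 'I_q.+1 -> nat) (G : 'M[S]_(q.+1, p)) (w : 'rV[S]_q.+1) b :
  generating d G -> w *m G = 0 -> (w 0 b)@_0%MM != 0 ->
  generating (fun i => d (lift b i)) (row' b G).
Proof.
move=> [ZG gG spanG] wG0 nz_wb; split=> [i|a c m|v /spanG[x ->]].
- have [? ?] := ZG (lift b i); split=> //.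
  by have -> : row i (row' b G) = row (lift b i) G by apply/rowP => j; rewrite !mxE.
- by rewrite mxE; exact: gG.
pose c := (w 0 b)@_0%MM.
(* The component of degree [d b] of [w] is still a relation, and its coefficient at b is the nonzero
   scalar c. *)
have [u uG0 ub] : exists2 u : 'rV[S]_q.+1, u *m G = 0 & u 0 b = c%:MP.
  exists (fcomp d (d b) w); last by rewrite mxE leqnn subnn pihomog_0.
  by rewrite -(fcompM _ _ gG) wG0 fcomp_id //; exact: fhomog0.
pose y := x - (x 0 b * (c^-1)%:MP) *: u.
have yb : y 0 b = 0 by rewrite !mxE ub -mulrA -mpolyCM mulVf // mpolyC1 mulr1 subrr.
exists (col' b y); have -> : x *m G = y *m G by rewrite mulmxBl -scalemxAl uG0 scaler0 subr0.
apply/rowP => j; rewrite !mxE (bigD1_ord b) //= yb mul0r add0r.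
by apply: eq_bigr => i _; rewrite !mxE.
Qed.

Lemma minimal_generating : exists q (d : 'I_q -> nat) (G : 'M[S]_(q, p)),
  generating d G /\ forall (w : 'rV[S]_q) b, w *m G = 0 -> (w 0 b)@_0%MM = 0.
Proof.
pose P q := `[< exists (d : 'I_q -> nat) (G : 'M[S]_(q, p)), generating d G >].
have exP : exists q, P q.
  by have [q [d [G gG]]] := generating_exists; exists q; apply/asboolP; exists d, G.
case: (ex_minnP exP) => q /asboolP[d [G gG]] min_q; exists q, d, G; split=> // w b wG0.
apply/eqP; apply/negPn/negP => nz_wb.
case: q => [|q] in d G gG min_q w b wG0 nz_wb *; first by case: b {nz_wb}.
suff /min_q : P q by rewrite ltnn.
by apply/asboolP; exists (fun i => d (lift b i)), (row' b G); exact: generating_drop nz_wb.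
Qed.

End Step.
End Generators.

(** A degree function on ['I_p] becomes a list once for every property Q, which confines the
    transport along [size s = p] to this place. *)
Lemma seq_of_degrees (Q : forall p, ('I_p -> nat) -> Prop) p (d : 'I_p -> nat) :
  Q p d -> exists s : seq nat, Q (size s) (fun i => nth 0%N s i).
Proof.
have: Q p (fun i => nth 0%N (codom d) i) -> exists s : seq nat, Q (size s) (fun i => nth 0%N s i).
  have e : size (codom d) = p by rewrite size_codom card_ord.
  by move: (codom d) e => s e; case: p / e d => _ Qs; exists s.
move=> H Qd; apply: H; congr (Q p _): Qd; apply/funext => i.
by have := nth_codom 0%N d (enum_rank i); rewrite enum_rankK enum_rank_ord => <-.
Qed.

(** * Construction of the minimal graded free resolution *)

Section Resolution.
Variables (K : fieldType) (N : nat).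
Local Notation S := {mpoly K[N]}.

(** In 0 -> Ker G -> F -> Z -> 0 the quotient F / Ker G is Z, with bound D, and F has shifts at most
    D; [kreg_sub] adds one. *)
Lemma kreg_syzygies p q (sh : 'I_p -> nat) (d : 'I_q -> nat) Z (G : 'M[S]_(q, p)) D :
    submod sh Z -> kreg (var_nth K N) N (fpart sh Z) (@fzero K N p) D -> generating sh Z D d G ->
  kreg (var_nth K N) N (fpart d (fun w => w *m G = 0)) (@fzero K N q) D.+1.
Proof.
move=> sZ rZ [ZG gG spanG].
have ZwG w : Z (w *m G) by apply: (submod_mulmx w sZ) => i; case: (ZG i).
have gK := fpart_graded (submod_ker gG); have gT := fpart_graded (submodT K N d).
apply: (@kreg_sub _ _ _ _ _ _ (fpart d (fun=> True)) _ gK).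
- by move=> t e ->; exact: (graded0 gK).
- by move=> t e [].
- by apply: kreg_free => i; case: (ZG i) => le_d _; exact: leqW.
apply: (@kreg_comap _ _ _ _ _ (mulmxr G) (fpart sh Z) (@fzero K N p) _ _ 0 D
  (@fzero_graded K N p) gT).
- move=> t w [hw _]; rewrite addn0; split; [exact: fgraded_mx_homog hw | exact: ZwG].
- by move=> t w [_ wG0].
- move=> t v; rewrite addn0 => -[hv /spanG[w def_v]]; exists (fcomp d t w).
    by split=> //; exact: fcomp_homog.
  by rewrite /fzero /= -(fcompM _ _ gG) -def_v fcomp_id // subrr.
- by move=> t w [hw _] wG0; split.
- by rewrite addn0.
Qed.

(* One step of the construction: a free module and the submodule of it that
   remains to be resolved. *)
Record stage := Stage {
  st_s : seq nat;
  st_Z : 'rV[S]_(size st_s) -> Prop;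
  st_D : nat;
  st_sub : submod (fun i => nth 0%N st_s i) st_Z;
  st_reg : kreg (var_nth K N) N (fpart (fun i => nth 0%N st_s i) st_Z) (@fzero K N _) st_D;
  st_min : forall v b, st_Z v -> (v 0 b)@_0%MM = 0
}.

Arguments st_Z : clear implicits.
Arguments st_reg : clear implicits.
Arguments st_min : clear implicits.

(** The free module of Y maps onto [st_Z X] with kernel [st_Z Y], so consecutive stages splice into
    an exact complex. *)
Definition covers (X Y : stage) (G : 'M[S]_(size (st_s Y), size (st_s X))) : Prop :=
  [/\ fgraded_mx (fun i => nth 0%N (st_s Y) i) (fun i => nth 0%N (st_s X) i) G,
      forall j, j \in st_s Y -> (j <= st_D X)%N,
      st_D Y = (st_D X).+1,
      forall v, st_Z X v <-> exists w, v = w *m G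
    & forall w, st_Z Y w <-> w *m G = 0].

Arguments covers : clear implicits.

Lemma next_stage X : exists Y G, covers X Y G.
Proof.
have [q [d [G [genG minG]]]] := minimal_generating (st_sub X) (st_reg X).
pose Q q (d : 'I_q -> nat) := exists G : 'M[S]_(q, size (st_s X)),
  generating (fun i => nth 0%N (st_s X) i) (st_Z X) (st_D X) d G /\
  forall (w : 'rV[S]_q) b, w *m G = 0 -> (w 0 b)@_0%MM = 0.
have /seq_of_degrees[s [{}G [{}genG {}minG]]] : Q q d by exists G.
have [ZG gG spanG] := genG.
exists (Stage (submod_ker gG) (kreg_syzygies (st_sub X) (st_reg X) genG) minG), G.
split=> //= [j|v].
  by move=> /(nthP 0%N)[i lt_i <-]; case: (ZG (Ordinal lt_i)).
split=> [/spanG//|[w ->]]; apply: (submod_mulmx w (st_sub X)) => i; case: (ZG i) => _; exact.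
Qed.

(** The first stage is I inside S, with bound [m.+1] by [kreg_sub], so F_(i+1) has shifts at most
    [i + m.+1]. The augmentation is an identity matrix; its bijectivity later identifies F_0 with
    S. *)
Lemma resolution_exists (I : {pred S}) m :
    homog_ideal (fun f => f \in I) -> (forall f, f \in I -> f@_0%MM = 0) ->
    kreg (var_nth K N) N (gpart (fun=> True)) (gpart (fun f => f \in I)) m ->
  exists F, [/\ minimal_graded_resolution I F, bijective (@augm_map K N F)
    & forall i j, j \in shifts F i -> (j <= i + m)%N].
Proof.
move=> [iI hI] I0 rI; pose s0 := [:: 0%N]; pose sh0 (i : 'I_(size s0)) := nth 0%N s0 i.
pose Z0 (v : 'rV[S]_(size s0)) := v 0 0 \in I.
have sZ0 : submod sh0 Z0.
  split=> [|u v Iu Iv|c u Iu|t u Iu]; rewrite /Z0 ?mxE; first exact: ideal0 iI.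
  - by rewrite ?mxE; exact: (idealB iI).
  - exact: (idealM iI).
  - by rewrite /= subn0; exact: hI.
have Z0min v b : Z0 v -> (v 0 b)@_0%MM = 0 by rewrite [b]ord1; exact: I0.
have rZ0 : kreg (var_nth K N) N (fpart sh0 Z0) (@fzero K N _) m.+1.
  have gZ := fpart_graded sZ0.
  apply: (@kreg_sub _ _ _ _ _ _ (fpart sh0 (fun=> True)) _ gZ).
  - by move=> t e ->; exact: (graded0 gZ).
  - by move=> t e [].
  - by apply: kreg_free => i; rewrite [i]ord1.
  rewrite -[m]addn0.
  have gS := gpart_graded (homog_idealW (@idealT K N)).
  refine (@kreg_map S (var_nth K N) N _ _ (@inject K N 1 ord0)
    (fpart sh0 (fun=> True)) (fpart sh0 Z0) (gpart (fun=> True)) (gpart (fun f => f \in I))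
    0 m gZ gS _ _ _ _ rI).
  - move=> t c [hc _]; split=> //; apply/fhomogP => b.
    by rewrite [b]ord1 mxE /= subn0 addn0.
  - move=> t c [hc Ic]; split; last by rewrite /Z0 mxE.
    by apply/fhomogP => b; rewrite [b]ord1 mxE /= subn0 addn0.
  - move=> t v [/fhomogP/(_ ord0) hv _]; exists (v 0 0); first by rewrite /= subn0 addn0 in hv.
    have e : @inject K N 1 ord0 (v 0 0) = v by apply/rowP => b; rewrite [b]ord1 mxE.
    by rewrite /= e subrr; exact: (graded0 gZ).
  - by move=> t c [hc _] [_]; rewrite /Z0 mxE.
pose X0 := Stage sZ0 rZ0 Z0min.
have [next nextP] := choice next_stage.
pose chain := fix chain i := if i is i'.+1 then next (chain i') else X0.
have nextP' i : exists G, covers (chain i) (chain i.+1) G by exact: nextP.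
pose G i := projT1 (cid (nextP' i)).
have GP i : covers (chain i) (chain i.+1) (G i) := projT2 (cid (nextP' i)).
pose F := @FreeComplex K N (fun i => st_s (chain i)) 1%:M G.
have chainD i : st_D (chain i) = (i + m.+1)%N.
  by elim: i => // i IHi; have [_ _ -> _ _] := GP i; rewrite IHi.
have augmE v : @augm_map K N F v = v 0 0 by rewrite /augm_map /= mulmx1.
exists F; split; last first.
- move=> [|i] j; first by rewrite inE => /eqP ->.
  have [_ le_D _ _ _] := GP i; move/le_D; rewrite chainD addSnnS; exact.
- exists (fun f => const_mx f) => [v|f]; rewrite augmE ?mxE //.
  by apply/rowP => b; rewrite mxE [b]ord1.
split.
- move=> a b m'; rewrite [a]ord1 [b]ord1 /= mxE eqxx msupp1 inE => /eqP ->.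
  by rewrite mdeg0.
- by move=> i; case: (GP i).
- move=> f; exists (const_mx f); rewrite augmE mxE subrr; exact: ideal0 iI.
- by move=> v; rewrite augmE; case: (GP 0%N) => _ _ _ + _; exact.
- move=> i v; have [_ _ _ _ kerG] := GP i; have [_ _ _ imG _] := GP i.+1.
  by split=> [/kerG/imG//|/imG/kerG].
(* Row a of the differential lies in [st_Z (chain i)], whose vectors have no constant terms. *)
- move=> i a b; have [_ _ _ imG _] := GP i.
  have := st_min (chain i) _ b (iffRL (imG _) (ex_intro _ (delta_mx 0 a) erefl)).
  by rewrite -rowE mxE.
Qed.

End Resolution.

(** * Partial derivatives at the origin *)

Section Taylor.
Variables (K : fieldType) (N : nat).
Local Notation S := {mpoly K[N]}.
Implicit Types (p q : S) (a b c u v : 'I_N).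

Definition der0 p : K := p@_0%MM.
Definition der1 a p : K := der0 p^`M(a).
Definition der2 a b p : K := der1 b p^`M(a).
Definition der3 a b c p : K := der2 b c p^`M(a).

Lemma der0_linear : linear (der0 : S -> K^o).
Proof. by move=> x p q; rewrite /der0 mcoeffD mcoeffZ. Qed.
Lemma der1_linear a : linear (der1 a : S -> K^o).
Proof. by move=> x p q; rewrite /der1 mderivD mderivZ der0_linear. Qed.
Lemma der2_linear a b : linear (der2 a b : S -> K^o).
Proof. by move=> x p q; rewrite /der2 mderivD mderivZ der1_linear. Qed.
Lemma der3_linear a b c : linear (der3 a b c : S -> K^o).
Proof. by move=> x p q; rewrite /der3 mderivD mderivZ der2_linear. Qed.

HB.instance Definition _ := GRing.isLinear.Build K S K^o _ der0 der0_linear.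
HB.instance Definition _ a := GRing.isLinear.Build K S K^o _ (der1 a) (der1_linear a).
HB.instance Definition _ a b := GRing.isLinear.Build K S K^o _ (der2 a b) (der2_linear a b).
HB.instance Definition _ a b c :=
  GRing.isLinear.Build K S K^o _ (der3 a b c) (der3_linear a b c).

Lemma der0Z x p : der0 (x *: p) = x * der0 p.
Proof. exact: mcoeffZ. Qed.
Lemma der1Z a x p : der1 a (x *: p) = x * der1 a p.
Proof. by rewrite /der1 mderivZ der0Z. Qed.
Lemma der2Z a b x p : der2 a b (x *: p) = x * der2 a b p.
Proof. by rewrite /der2 mderivZ der1Z. Qed.

Lemma der0M p q : der0 (p * q) = der0 p * der0 q.
Proof. exact: rmorphM. Qed.

Lemma der1M a p q : der1 a (p * q) = der1 a p * der0 q + der0 p * der1 a q.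
Proof. by rewrite /der1 mderivM raddfD /= !der0M. Qed.

Lemma der2M a b p q : der2 a b (p * q) =
  der2 a b p * der0 q + der1 a p * der1 b q + der1 b p * der1 a q + der0 p * der2 a b q.
Proof. by rewrite /der2 mderivM raddfD /= !der1M /der1; ring. Qed.

(** Leibniz rule for p of order at least one and q of order at least two at the origin: only linear
    times quadratic parts survive. *)
Lemma der3M a b c p q : der0 p = 0 -> der0 q = 0 -> (forall d, der1 d q = 0) ->
  der3 a b c (p * q) = der1 a p * der2 b c q + der1 b p * der2 a c q + der1 c p * der2 a b q.
Proof.
move=> p0 q0 q1; rewrite /der3 mderivM raddfD /= !der2M q0 q1 p0 !mulr0 !mul0r !add0r !addr0.
have q1' d : der0 q^`M(d) = 0 by exact: q1.
by rewrite !q1 q1' /der2 /der1 !mulr0 !add0r addrA.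
Qed.

Lemma der2C a b p : der2 a b p = der2 b a p.
Proof. by rewrite /der2 /der1 mderiv_comm. Qed.

Lemma der0X u : der0 'X_u = 0.
Proof. by rewrite /der0 mcoeffX; case: eqP => // /(congr1 mdeg); rewrite mdeg1 mdeg0. Qed.

Lemma der1X a u : der1 a 'X_u = (u == a)%:R.
Proof. by rewrite /der1 /der0 mcoeff_deriv mnm0E mulr1n add0m mcoeffXU. Qed.

Lemma der2XX a b u v : der2 a b ('X_u * 'X_v) =
  (u == a)%:R * (v == b)%:R + (u == b)%:R * (v == a)%:R.
Proof. by rewrite der2M !der0X !der1X; ring. Qed.

Lemma der2_deg a b p : (forall m, m \in msupp p -> mdeg m != 2%N) -> der2 a b p = 0.
Proof.
move=> deg_p; rewrite /der2 /der1 /der0 !mcoeff_deriv.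
rewrite (_ : p@__ = 0) ?mul0rn //; apply/eqP; rewrite mcoeff_eq0.
by apply/negP => /deg_p; rewrite !mdegD mdeg0 !mdeg1.
Qed.

End Taylor.

(** * The 2-minors of a generic 2 x n matrix *)

Section Determinantal.
Variables (K : fieldType) (n : nat).
Local Notation S := {mpoly K[n + n]}.
Local Notation T := {mpoly {poly K}[n]}.
Local Notation x_ := (@xvar K n).
Local Notation y_ := (@yvar K n).
Implicit Types (p q : S) (W : {set 'I_n}) (i j : 'I_n).

Definition vertex (k : 'I_(n + n)) : 'I_n := match split k with inl i | inr i => i end.

Lemma vertexl i : vertex (lshift n i) = i. Proof. by rewrite /vertex (unsplitK (inl i)). Qed.
Lemma vertexr i : vertex (rshift n i) = i. Proof. by rewrite /vertex (unsplitK (inr i)). Qed.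

Lemma vertexP (P : 'I_(n + n) -> Prop) :
  (forall i, P (lshift n i)) -> (forall i, P (rshift n i)) -> forall k, P k.
Proof. by move=> Pl Pr k; rewrite -(splitK k); case: (split k). Qed.

Definition edge_binomial i j : S := x_ i * y_ j - x_ j * y_ i.
Local Notation bin := edge_binomial.

Lemma dhomog_x i : x_ i \is 1.-homog. Proof. exact: dhomog_var. Qed.
Lemma dhomog_y i : y_ i \is 1.-homog. Proof. exact: dhomog_var. Qed.

Lemma dhomog_bin i j : bin i j \is 2.-homog.
Proof.
by apply: rpredB; apply: (@dhomogM _ _ _ 1 _ 1); rewrite ?dhomog_x ?dhomog_y.
Qed.

(* The parametrization x_i = t s_i, y_i = s_i (i in W) of the 2 x W matrices of
   rank at most one; t is a scalar of the target, so that phi preserves degrees. *)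
Definition phi W : S -> T :=
  mmap (@mpolyC n {poly K} \o @polyC K) (fun k =>
    match split k with
    | inl i => if i \in W then (polyX K)%:MP * 'X_i else 0
    | inr i => if i \in W then 'X_i else 0
    end).

HB.instance Definition _ W := GRing.RMorphism.copy (phi W) (phi W).

Lemma phiC W c : phi W c%:MP = c%:P%:MP. Proof. exact: mmapC. Qed.

Lemma phi_x W i : phi W (x_ i) = if i \in W then (polyX K)%:MP * 'X_i else 0.
Proof. by rewrite /phi mmapX mmap1U (unsplitK (inl i)). Qed.

Lemma phi_y W i : phi W (y_ i) = if i \in W then 'X_i else 0.
Proof. by rewrite /phi mmapX mmap1U (unsplitK (inr i)). Qed.

Lemma phi_bin W i j : i \in W -> j \in W -> phi W (bin i j) = 0.
Proof. by move=> Wi Wj; rewrite rmorphB !rmorphM /= !phi_x !phi_y Wi Wj; ring. Qed.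

Lemma ker_phi W : homog_ideal (fun p => phi W p = 0).
Proof.
have hom_X i : 'X_i \is [in {poly K}[n], 1.-homog] by rewrite dhomogX /= mdeg1.
have hom_C c : c%:MP \is [in {poly K}[n], 0.-homog].
  by rewrite dhomogE msuppC; case: ifP => //=; rewrite mdeg0.
apply: ideal_ker => [c|] /=; first by rewrite phiC.
apply: vertexP => i; rewrite -/(x_ i) -/(y_ i) ?phi_x ?phi_y; case: ifP => _ //;
  try exact: dhomog0.
exact: (@dhomogM _ _ _ 0 _ 1).
Qed.

(** Specialization t = 0 with s_i sent to y_i; after [phi W] it kills the x's and the variables
    outside W, and fixes the remaining y's. *)
Definition at_t0 : T -> S := mmap (@mpolyC _ K \o horner_eval 0) y_.

HB.instance Definition _ := GRing.RMorphism.copy at_t0 at_t0.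

Definition outside W := [set k : 'I_(n + n) | vertex k \notin W].
Definition xs_or_outside W := [set k : 'I_(n + n) | (k < n)%N || (vertex k \notin W)].

Lemma kill_outside_x W i : kill (outside W) (x_ i) = if i \in W then x_ i else 0.
Proof. by rewrite killX inE vertexl; case: (i \in W). Qed.

Lemma kill_outside_y W i : kill (outside W) (y_ i) = if i \in W then y_ i else 0.
Proof. by rewrite killX inE vertexr; case: (i \in W). Qed.

Lemma kill_outside_bin W i j :
  kill (outside W) (bin i j) = if (i \in W) && (j \in W) then bin i j else 0.
Proof.
rewrite rmorphB !rmorphM /= !kill_outside_x !kill_outside_y.
by case: (i \in W); case: (j \in W) => //=; rewrite ?mulr0 ?mul0r subrr.
Qed.

Lemma at_t0_phi W p : at_t0 (phi W p) = kill (xs_or_outside W) p.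
Proof.
apply: (@rmorph_mpoly_ext _ _ _ (at_t0 \o phi W) (kill (xs_or_outside W))) => [c|] /=.
  by rewrite phiC killC /at_t0 mmapC /= horner_evalE hornerC.
apply: vertexP => i; rewrite -/(x_ i) -/(y_ i) ?phi_x ?phi_y killX inE /=.
  rewrite ltn_ord /=; case: ifP => _; last exact: raddf0.
  by rewrite rmorphM /= /at_t0 mmapC /= horner_evalE hornerX mpolyC0 mul0r.
rewrite ltnNge leq_addr vertexr /=; case: ifP => _; last exact: raddf0.
by rewrite /at_t0 mmapX mmap1U.
Qed.

Definition at_vertex i := [set k : 'I_(n + n) | vertex k == i].

Lemma phi_kill W i p : phi W (kill (at_vertex i) p) = phi (W :\ i) p.
Proof.
apply: (@rmorph_mpoly_ext _ _ _ (phi W \o kill (at_vertex i)) (phi (W :\ i))) => [c|] /=.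
  by rewrite killC !phiC.
apply: vertexP => j; rewrite killX inE ?vertexl ?vertexr -/(x_ j) -/(y_ j);
  rewrite ?phi_x ?phi_y !inE; case: ifP => _; rewrite ?raddf0 //= -/(x_ j) -/(y_ j).
- by rewrite phi_x.
- by rewrite phi_y.
Qed.

Lemma phi_outside W p : phi W (kill (outside W) p) = phi W p.
Proof.
apply: (@rmorph_mpoly_ext _ _ _ (phi W \o kill (outside W)) (phi W)) => [c|] /=.
  by rewrite killC.
apply: vertexP => j; rewrite -/(x_ j) -/(y_ j) ?kill_outside_x ?kill_outside_y;
  by case: ifP => Wj; rewrite ?raddf0 ?phi_x ?phi_y ?Wj.
Qed.

Definition minors W x := exists i j, [/\ i \in W, j \in W & x = bin i j].
(** The expected kernel of [phi W]; equality is [ker_phiP]. *)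
Definition rank1_ideal W := ideal_span (fun x => minors W x \/ vars_in (outside W) x).

Lemma rank1_ideal_homog W : homog_ideal (rank1_ideal W).
Proof.
apply: ideal_span_homog => _ [[i [j [_ _ ->]]]|[k _ ->]].
- by exists 2; exact: dhomog_bin.
- by exists 1; exact: dhomog_var.
Qed.

Lemma rank1_ideal_sub_ker W p : rank1_ideal W p -> phi W p = 0.
Proof.
apply: (@ideal_span_min _ _ _ (fun p => phi W p = 0)); first by case: (ker_phi W).
move=> _ [[i [j [Wi Wj ->]]]|[k Wk ->]]; first exact: phi_bin.
by rewrite -phi_outside killX Wk raddf0.
Qed.

Lemma comap_ideal (I : S -> Prop) c : is_ideal I -> is_ideal (fun q => I (c * q)).
Proof.
move=> iI; split=> [|u v Iu Iv|d u Iu]; first by rewrite mulr0; apply: ideal0.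
- by rewrite mulrBr; apply: idealB.
- by rewrite mulrCA; apply: idealM.
Qed.

(** At t = 0 the multiple of x_i disappears and y_i times the restriction of q remains, in a
    domain. *)
Lemma adjoin_x_colon_y W i q : i \in W ->
  adjoin (fun p => phi W p = 0) (x_ i) (y_ i * q) -> kill (xs_or_outside W) q = 0.
Proof.
move=> Wi [r /(congr1 at_t0)]; rewrite raddf0 at_t0_phi rmorphB !rmorphM /= !killX !inE /=.
rewrite ltn_ord ltnNge leq_addr vertexr Wi /= mulr0 subr0 => /eqP.
by rewrite mulf_eq0 (negPf (mpolyXU_neq0 _ _)) => /eqP.
Qed.

(** Modulo the minors, y_i x_j equals x_i y_j. This concerns [rank1_ideal], since it serves to prove
    that this ideal is the kernel. *)
Lemma xs_or_outside_adjoin W i q : i \in W ->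
  kill (xs_or_outside W) q = 0 -> adjoin (rank1_ideal W) (x_ i) (y_ i * q).
Proof.
move=> Wi /ker_killP; have [iG _] := adjoin_ideal (dhomog_x i) (rank1_ideal_homog W).
apply: (@ideal_span_min _ _ _ (fun q => adjoin (rank1_ideal W) (x_ i) (y_ i * q))).
  exact: comap_ideal.
move=> _ [k Tk ->]; have [Wk|notWk] := boolP (vertex k \in W); last first.
  apply: idealM => //; apply: sub_adjoin; apply: mem_ideal_span; right.
  by exists k; rewrite ?inE.
elim/vertexP: k Tk Wk => j; rewrite inE ?vertexl ?vertexr => Tj Wj; last first.
  by rewrite Wj orbF ltnNge leq_addr in Tj.
exists (y_ j); apply: mem_ideal_span; left; exists j, i; split=> //.
  by rewrite /edge_binomial /xvar /yvar; ring.
Qed.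

Lemma at_vertex_adjoin i (I : S -> Prop) p : homog_ideal I ->
  I (kill (at_vertex i) p) -> adjoin (adjoin I (x_ i)) (y_ i) p.
Proof.
move=> hI Ip; have hIx := adjoin_ideal (dhomog_x i) hI.
have [iA _] := adjoin_ideal (dhomog_y i) hIx; have [iIx _] := hIx; have [iI _] := hI.
rewrite -[p](subrK (kill (at_vertex i) p)); apply: idealD => //; last first.
  by apply: sub_adjoin; apply: sub_adjoin.
apply: (ideal_span_min iA) (kill_subr _ _) => _ [k + ->]; rewrite inE => /eqP.
by elim/vertexP: k => j; rewrite ?vertexl ?vertexr => ->;
  [apply: sub_adjoin|]; apply: mem_adjoin.
Qed.

Lemma phiD1_adjoin W i p : phi (W :\ i) p = 0 ->
  adjoin (adjoin (fun p => phi W p = 0) (x_ i)) (y_ i) p.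
Proof. by rewrite -phi_kill; apply: at_vertex_adjoin; exact: ker_phi. Qed.

Lemma rank1_idealD1_adjoin W i p :
  rank1_ideal (W :\ i) p -> adjoin (adjoin (rank1_ideal W) (x_ i)) (y_ i) p.
Proof.
have hIx := adjoin_ideal (dhomog_x i) (rank1_ideal_homog W).
have [iA _] := adjoin_ideal (dhomog_y i) hIx; have [iIx _] := hIx.
have [iG _] := rank1_ideal_homog W.
apply: (ideal_span_min iA) => _ [[j [k [/setD1P[_ Wj] /setD1P[_ Wk] ->]]]|[k + ->]].
  by apply: sub_adjoin; apply: sub_adjoin; apply: mem_ideal_span; left; exists j, k.
have [Wk|notWk] := boolP (vertex k \in W); last first.
  move=> _; apply: sub_adjoin; apply: sub_adjoin; apply: mem_ideal_span; right.
  by exists k; rewrite ?inE.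
rewrite !inE Wk andbT negbK => /eqP.
by elim/vertexP: k {Wk} => j; rewrite ?vertexl ?vertexr => ->;
  [apply: sub_adjoin|]; apply: mem_adjoin.
Qed.

(** Setting s_i = 0 off W in the target factors [phi] of a smaller set through [phi] of a larger
    one. *)
Definition keep_rows W : T -> T :=
  mmap (@mpolyC n {poly K}) (fun i => if i \in W then 'X_i else 0).

HB.instance Definition _ W := GRing.RMorphism.copy (keep_rows W) (keep_rows W).

Lemma keep_rowsC W c : keep_rows W c%:MP = c%:MP. Proof. exact: mmapC. Qed.

Lemma keep_rowsX W i : keep_rows W 'X_i = if i \in W then 'X_i else 0.
Proof. by rewrite /keep_rows mmapX mmap1U. Qed.

Lemma phi_subset W W' p : W' \subset W -> phi W p = 0 -> phi W' p = 0.
Proof.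
move=> sW'W php0; suff <- : keep_rows W' (phi W p) = phi W' p by rewrite php0 raddf0.
apply: (@rmorph_mpoly_ext _ _ _ (keep_rows W' \o phi W) (phi W')) => [c|] /=.
  by rewrite !phiC keep_rowsC.
apply: vertexP => j; rewrite -/(x_ j) -/(y_ j) ?phi_x ?phi_y;
  have := subsetP sW'W j; case: ifP => Wj.
- by rewrite rmorphM /= keep_rowsC keep_rowsX; case: ifP => // _; rewrite mulr0.
- by case: ifP => [_ /(_ isT)|] //; rewrite raddf0.
- by rewrite keep_rowsX.
- by case: ifP => [_ /(_ isT)|] //; rewrite raddf0.
Qed.

(* Setting x_i = y_i = 0 gives p = x_i r + y_i q modulo the span, by induction on
   W; then t = 0 shows that y_i q lies in the span plus (x_i), so p = x_i q2
   modulo the span with phi q2 = 0, and one concludes by induction on the degree. *)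
Lemma ker_phi_homog_gen W d p : p \is d.-homog -> phi W p = 0 -> rank1_ideal W p.
Proof.
have [k] := ubnP #|W|; elim: k W d p => // k IHk W.
move=> d p lt_k; have [W0|[i Wi]] := set_0Vmem W.
  move=> _ php0; have [iG _] := rank1_ideal_homog W.
  have kp0 : kill (outside W) p = 0.
    have oT : outside W = setT by apply/setP => v; rewrite !inE W0 inE.
    move: php0; rewrite -phi_outside oT killT phiC => /eqP.
    by rewrite mpolyC_eq0 polyC_eq0 => /eqP ->; rewrite mpolyC0.
  apply: (ideal_span_min iG) (iffLR (ker_killP _ _) kp0) => x Wx.
  by apply: mem_ideal_span; right; exact: Wx.
elim: d p lt_k => [|d IHd] p lt_k hp php0.
  rewrite (dhomog0E hp) phiC in php0 *; move/eqP: php0.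
  by rewrite mpolyC_eq0 polyC_eq0 => /eqP ->; rewrite mpolyC0; exact: ideal_span0.
have [iG _] := rank1_ideal_homog W.
have [q Apq] : adjoin (adjoin (rank1_ideal W) (x_ i)) (y_ i) p.
  apply: rank1_idealD1_adjoin; apply: (IHk _ d.+1 p _ hp).
    by apply: leq_trans (ltnSE lt_k); rewrite [#|W|](cardsD1 i) Wi.
  exact: phi_subset (subD1set _ _) php0.
case: Apq => r Gpqr; have phpqr := rank1_ideal_sub_ker Gpqr.
have [s Gqs] : adjoin (rank1_ideal W) (x_ i) (y_ i * q).
  apply: xs_or_outside_adjoin => //; apply: (adjoin_x_colon_y Wi); exists (- r).
  have -> : y_ i * q - - r * x_ i = p - (p - q * y_ i - r * x_ i) by ring.
  by rewrite rmorphB /= php0 phpqr subrr.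
have [q2 hq2 [_ Gpq2]] : exists2 q2, q2 \is d.-homog & gpart (rank1_ideal W) d.+1 (p - x_ i * q2).
  apply: (homog_split (rank1_ideal_homog W) (dhomog_x i) hp); exists (r + s).
  have -> : p - (r + s) * x_ i = (p - q * y_ i - r * x_ i) + (y_ i * q - s * x_ i) by ring.
  exact: idealD.
rewrite -[p](subrK (x_ i * q2)); apply: idealD => //; apply: idealM => //.
apply: (IHd _ lt_k hq2); have /eqP := rank1_ideal_sub_ker Gpq2.
rewrite rmorphB /= php0 rmorphM /= phi_x Wi sub0r oppr_eq0 !mulf_eq0 mpolyC_eq0 polyX_eq0.
by rewrite (negPf (mpolyXU_neq0 _ _)) => /eqP.
Qed.

Lemma ker_phiP W p : phi W p = 0 <-> rank1_ideal W p.
Proof.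
split=> [php0|]; last exact: rank1_ideal_sub_ker.
rewrite (@pihomog_sum _ _ p _ (leqnn _)); apply: ideal_sum => [|d _].
  exact: homog_idealW (rank1_ideal_homog W).
apply: (@ker_phi_homog_gen _ d); first exact: pihomogP.
exact: (ideal_pihomog (ker_phi W)).
Qed.

(** Let A1 be the kernel plus (x_i) and P' the kernel of [phi (W :\ i)]. Then P' / A1 is generated
    by y_i with annihilator the ideal of [xs_or_outside W], so it has regularity at most 1;
    extension by S / P' gives S / A1, and the nonzerodivisor x_i gives the claim. *)
Lemma kreg_phi W :
  kreg (var_nth K (n + n)) (n + n) (gpart (fun=> True)) (gpart (fun p => phi W p = 0)) 1.
Proof.
have [k] := ubnP #|W|; elim: k W => // k IHk W lt_k.
have gT := gpart_graded (homog_idealW (@idealT K (n + n))).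
have hP := ker_phi W; have gP := gpart_graded (homog_idealW hP).
have [W0|[i Wi]] := set_0Vmem W.
  apply: kreg_trivial => // t e [he _]; split=> //.
  have oT : outside W = setT by apply/setP => v; rewrite !inE W0 inE.
  rewrite -phi_outside oT killT phiC (dhomog_nemf_coeff he) ?polyC0 ?mpolyC0 //.
  by rewrite /= mdeg0.
have hx := dhomog_x i; have hy := dhomog_y i.
pose A1 := adjoin (fun p => phi W p = 0) (x_ i).
have hA1 : homog_ideal A1 := adjoin_ideal hx hP.
have gA1 := gpart_graded (homog_idealW hA1).
have sA1P' p : A1 p -> phi (W :\ i) p = 0.
  case=> q /(phi_subset (subD1set W i)) /eqP.
  by rewrite rmorphB rmorphM /= phi_x !inE eqxx mulr0 subr0 => /eqP.
have rA1 : kreg (var_nth K (n + n)) (n + n) (gpart (fun=> True)) (gpart A1) 1.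
  apply: (@kreg_ext _ _ _ _ (gpart (fun p => phi (W :\ i) p = 0)) _ _ _ gT).
  - by move=> t e [he /sA1P'].
  - by move=> t e [he _].
  - rewrite -[1%N]add0n.
    apply: (@kreg_map _ _ _ _ _ ( *:%R (y_ i) : {linear S^o -> S^o}) _ _ _
      (gpart (fun p => kill (xs_or_outside W) p = 0)) _ _ gA1 gT); last exact: kreg_kill.
    + move=> t e [he _]; split; first by rewrite addn1 -add1n; apply: dhomogM.
      by rewrite /= /GRing.scale /= rmorphM /= phi_y !inE eqxx mul0r.
    + move=> t e [he /(xs_or_outside_adjoin Wi) [q Gq]].
      split; first by rewrite addn1 -add1n; apply: dhomogM.
      by exists q; apply/rank1_ideal_sub_ker.
    + move=> t e [he /phiD1_adjoin Ae]; rewrite addn1 in he *.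
      by have [q hq Bq] := homog_split hA1 hy he Ae; exists q.
    + move=> t e [he _] [_ Ae]; split=> //.
      exact: (adjoin_x_colon_y Wi).
  - by apply: IHk; apply: leq_trans (ltnSE lt_k); rewrite [#|W|](cardsD1 i) Wi.
apply: (@kreg_regular _ _ _ _ _ _ (gpart A1) _ (lshift n i)) => //.
- by move=> t e [he Pe]; split=> //; apply: sub_adjoin.
- move=> t e [he _] [_]; rewrite var_nthE -/(x_ i) /= /GRing.scale /= => /eqP.
  rewrite rmorphM /= phi_x Wi !mulf_eq0 mpolyC_eq0 polyX_eq0.
  by rewrite (negPf (mpolyXU_neq0 _ _)) => /eqP.
- move=> t e [he Ae]; rewrite var_nthE -/(x_ i).
  by have [q hq Bq] := homog_split hP hx he Ae; exists q.
Qed.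

End Determinantal.

(** * Complete multipartite graphs *)

Section IdealGen.
Variables (K : fieldType) (N : nat) (gs : seq {mpoly K[N]}).
Local Notation S := {mpoly K[N]}.

Lemma ideal_genP f : f \in ideal_gen gs <->
  exists c : 'I_(size gs) -> S, f = \sum_(i < size gs) c i * gs`_i.
Proof. by split=> [/asboolP|?]; last apply/asboolP. Qed.

Lemma ideal_gen_ideal : is_ideal (fun f => f \in ideal_gen gs).
Proof.
split=> [|u v /ideal_genP[c ->] /ideal_genP[d ->]|u v /ideal_genP[c ->]]; apply/ideal_genP.
- by exists (fun=> 0); rewrite big1 // => i _; rewrite mul0r.
- by exists (fun i => c i - d i); rewrite -sumrB; apply: eq_bigr => i _; rewrite mulrBl.
- by exists (fun i => u * c i); rewrite mulr_sumr; apply: eq_bigr => i _; rewrite mulrA.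
Qed.

Lemma mem_ideal_gen g : g \in gs -> g \in ideal_gen gs.
Proof.
move=> gs_g; apply/ideal_genP; have lt_g : (index g gs < size gs)%N by rewrite index_mem.
exists (fun i => (i == Ordinal lt_g)%:R).
rewrite (bigD1 (Ordinal lt_g)) //= eqxx mul1r nth_index // big1 ?addr0 // => i /negPf ->.
by rewrite mul0r.
Qed.

Lemma ideal_gen_min (I : S -> Prop) : is_ideal I ->
  (forall g, g \in gs -> I g) -> forall f, f \in ideal_gen gs -> I f.
Proof.
move=> iI gsI f /ideal_genP[c ->]; apply: ideal_sum => // i _.
by apply: idealM => //; apply: gsI; rewrite mem_nth.
Qed.

End IdealGen.

Section Multipartite.
Variables (K : fieldType) (n r : nat) (V : 'I_r -> {set 'I_n}).
Hypothesis Vcover : forall i, exists l, i \in V l.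
Hypothesis Vdisj : forall i l m, i \in V l -> i \in V m -> l = m.
Local Notation S := {mpoly K[n + n]}.
Local Notation x_ := (@xvar K n).
Local Notation y_ := (@yvar K n).
Local Notation bin := (@edge_binomial K n).
Local Notation J := (@binomial_edge_ideal K n (multipartite_rel V)).
Local Notation killV l := (@kill K (n + n) (outside (V l))).
Local Notation edge := (multipartite_rel V).

Lemma edgeE i j l : i \in V l -> edge i j = (j \notin V l).
Proof.
move=> Vi; apply/existsP/idP => [[l' /existsP[m /and3P[ne_lm Vi' Vj]]]|notVj].
  apply: contraNN ne_lm => Vj'; apply/eqP.
  by rewrite (Vdisj Vi' Vi) (Vdisj Vj Vj').
have [m Vj] := Vcover j; exists l; apply/existsP; exists m; rewrite Vi Vj !andbT.
by apply: contraNneq notVj => ->.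
Qed.

Lemma edge_neq i j : edge i j -> i != j.
Proof.
have [l Vi] := Vcover i; rewrite (edgeE _ Vi) => notVj.
by apply: contraNneq notVj => <-.
Qed.

Lemma edge_sym i j : edge i j -> edge j i.
Proof.
move=> /existsP[l /existsP[m /and3P[ne_lm Vi Vj]]].
by apply/existsP; exists m; apply/existsP; exists l; rewrite eq_sym ne_lm Vi Vj.
Qed.

Lemma J_ideal : is_ideal (fun f => f \in J). Proof. exact: ideal_gen_ideal. Qed.

Lemma bin_edge i j : edge i j -> bin i j \in J.
Proof.
wlog lt_ij : i j / (i < j)%N => [hwlog eij|eij].
  have := edge_neq eij; rewrite neq_ltn => /orP[/hwlog|/hwlog]; first exact.
  move/(_ (edge_sym eij)) => Jji; have -> : bin i j = - bin j i by rewrite opprB.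
  by apply: (idealN J_ideal).
apply: mem_ideal_gen; apply/imageP; exists (i, j) => //.
by rewrite inE /= eij.
Qed.

Lemma J_min (I : S -> Prop) : is_ideal I ->
  (forall i j, edge i j -> I (bin i j)) -> forall f, f \in J -> I f.
Proof.
move=> iI eI; apply: ideal_gen_min => // g /imageP[[i j]].
by rewrite inE /= => /andP[eij _] ->; apply: eI.
Qed.

(** The relation x_v f_ij = x_i f_vj - x_j f_vi and its analogue for y_v, where vi and vj are
    edges. *)
Lemma var_bin k i j l : i \in V l -> j \in V l -> vertex k \notin V l -> 'X_k * bin i j \in J.
Proof.
move=> Vi Vj notVk.
have Jv v : v = vertex k -> bin v i \in J /\ bin v j \in J.
  by move=> ->; split; apply/bin_edge/edge_sym; rewrite (edgeE _ Vi, edgeE _ Vj).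
elim/vertexP: k notVk Jv => v; rewrite ?vertexl ?vertexr => _ /(_ v erefl) [Ji Jj].
  have -> : 'X_(lshift n v) * bin i j = x_ i * bin v j - x_ j * bin v i.
    by rewrite /edge_binomial /xvar /yvar; ring.
  by apply: (idealB J_ideal); apply: (idealM J_ideal).
have -> : 'X_(rshift n v) * bin i j = y_ i * bin v j - y_ j * bin v i.
  by rewrite /edge_binomial /xvar /yvar; ring.
by apply: (idealB J_ideal); apply: (idealM J_ideal).
Qed.

(* It suffices to consider multiples c f_ij with i, j in the same part V_l: then
   c f_ij - killV l (c f_ij) is a multiple of f_ij by elements of the ideal of
   the variables outside V_l, and these multiply f_ij into J. *)
Lemma J_residue f : phi setT f = 0 -> f - \sum_l killV l f \in J.
Proof.
move/ker_phiP; elim=> [|c x p + _ IHp].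
  by rewrite big1 ?subr0 => [|l _]; [exact: ideal0 J_ideal | rewrite raddf0].
have -> : c * x + p - \sum_l killV l (c * x + p)
        = (c * x - \sum_l killV l (c * x)) + (p - \sum_l killV l p).
  rewrite addrACA -opprD -big_split /=; congr (_ - _).
  by apply: eq_bigr => l _; rewrite rmorphD.
move=> Xx; apply: (idealD J_ideal) => //{p IHp}.
case: Xx => [[i [j [_ _ ->]]]|[k]]; last by rewrite !inE.
have [l Vi] := Vcover i; have [Vj|notVj] := boolP (j \in V l); last first.
  rewrite big1 ?subr0 => [|m _].
    by apply: (idealM J_ideal); apply: bin_edge; rewrite (edgeE _ Vi).
  rewrite rmorphM /= kill_outside_bin; case: ifP => [/andP[Vi' Vj]|_]; last by rewrite mulr0.
  by rewrite (Vdisj Vi Vi') Vj in notVj.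
rewrite (bigD1 l) //= big1 ?addr0 => [|m ne_ml]; last first.
  rewrite rmorphM /= kill_outside_bin; case: ifP => [/andP[Vi' _]|_]; last by rewrite mulr0.
  by rewrite (Vdisj Vi Vi') eqxx in ne_ml.
rewrite rmorphM /= kill_outside_bin Vi Vj /= -mulrBl mulrC.
apply: (ideal_span_min (comap_ideal (bin i j) J_ideal)) (kill_subr _ c).
by move=> _ [k + ->]; rewrite inE mulrC => Tk; exact: var_bin Tk.
Qed.

(** One direction is checked on generators; in the other, the sum subtracted in [J_residue] is
    zero. *)
Lemma JP f : f \in J <-> phi setT f = 0 /\ forall l, killV l f = 0.
Proof.
split=> [|[phf0 kf0]]; last first.
  by have := J_residue phf0; rewrite big1 ?subr0 => [|l _]; last exact: kf0.
have hI := ideal_bigcap (fun l (_ : True) => ker_kill K (outside (V l))).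
suff: f \in J -> phi setT f = 0 /\ (forall l, True -> killV l f = 0).
  by move=> H /H[? kf0]; split=> // l; apply: kf0.
apply: (@J_min (fun f => phi setT f = 0 /\ (forall l, True -> killV l f = 0))).
  exact: homog_idealW (idealI (ker_phi K _) hI).
move=> i j eij; split=> [|l _]; first by apply: phi_bin; rewrite inE.
rewrite kill_outside_bin; case: ifP => // /andP[Vi Vj].
by rewrite (edgeE _ Vi) Vj in eij.
Qed.

(** * Regularity of S / J through the partial intersections *)

Definition Jpartial (m : nat) (f : S) : Prop :=
  phi setT f = 0 /\ forall l : 'I_r, (l < m)%N -> killV l f = 0.

Lemma Jpartial_homog m : homog_ideal (Jpartial m).
Proof.
apply: idealI; first exact: ker_phi.
apply: (@ideal_bigcap K (n + n) _ (fun (l : 'I_r) f => killV l f = 0) (fun l => (l < m)%N)) => l _.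
exact: ker_kill.
Qed.

(** Minors on columns of V_l restrict to zero on all earlier parts, and the remaining generators of
    the kernel are variables in P_l; so the kernel is the sum of [Jpartial m] and P_l. *)
Lemma ker_phi_split (m : nat) (l : 'I_r) f : m = l -> phi (V l) f = 0 ->
  exists2 c, Jpartial m c & killV l (f - c) = 0.
Proof.
have [iJ _] := Jpartial_homog m.
move=> def_m /ker_phiP; elim=> [|c x p Xx _ [c' Jc' Pc']].
  by exists 0; [exact: ideal0 | rewrite subr0; exact: raddf0].
case: Xx => [[i [j [Vi Vj ->]]]|[k Tk ->]]; last first.
  exists c' => //; rewrite -addrA rmorphD rmorphM /= Pc' addr0.
  by rewrite killX Tk mulr0.
exists (c * bin i j + c'); last first.
  by rewrite opprD addrACA subrr add0r.
apply: (idealD iJ _ Jc'); apply: (idealM iJ); split=> [|q lt_qm].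
  by apply: phi_bin; rewrite inE.
rewrite kill_outside_bin; case: ifP => // /andP[Vqi _].
by rewrite def_m (Vdisj Vi Vqi) ltnn in lt_qm.
Qed.

Local Notation kregS := (kreg (var_nth K (n + n)) (n + n) (gpart (fun=> True))).

(* Jpartial m / Jpartial m.+1 is isomorphic to ker phi (V m) / (variables outside
   V m), which is a first syzygy module of a 1-regular module. *)
Lemma kreg_Jpartial m : (m <= r)%N -> kregS (gpart (Jpartial m)) 2.
Proof.
have gT := gpart_graded (homog_idealW (@idealT K (n + n))).
elim: m => [_|m IHm lt_mr].
  refine (kreg_iff _ (kreg_leq (leqnSn 1) (@kreg_phi K n setT))) => t e.
  by split=> [[he Pe]|[he [Pe _]]]; split.
pose l := Ordinal lt_mr.
have gJ k := gpart_graded (homog_idealW (Jpartial_homog k)).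
have gP := gpart_graded (homog_idealW (ker_kill K (outside (V l)))).
have gI := gpart_graded (homog_idealW (ker_phi K (V l))).
apply: (@kreg_ext _ _ _ _ (gpart (Jpartial m)) _ _ _ gT) => [t e [he [Pe ke]]|t e [he _]||] //.
- by split=> //; split=> // q lt_qm; apply: ke; rewrite ltnW.
- have sPI f : killV l f = 0 -> phi (V l) f = 0 by rewrite -phi_outside => ->; exact: raddf0.
  (* Second isomorphism theorem: [Jpartial m] modulo its intersection with P_l is the kernel of
     [phi (V l)] modulo P_l. *)
  apply: (@kreg_comap _ _ _ S^o S^o idfun (gpart (fun f => phi (V l) f = 0))
    (gpart (fun f => killV l f = 0)) _ _ 0 2 gP (gJ m)).
  + move=> t e [he [Pe _]]; rewrite addn0; split; first exact: he.
    exact: (phi_subset (subsetT _) Pe).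
  + move=> t e [he [Pe ke]]; rewrite addn0; split; [exact: he | exact: ke].
  + move=> t e; rewrite addn0 => -[he /(@ker_phi_split m l e erefl)[c Jc Pec]].
    exists (piH t c); first by split; [exact: pihomogP | exact: (ideal_pihomog (Jpartial_homog m))].
    split; first by apply: rpredB => //; exact: pihomogP.
    rewrite /= -[X in X - _](pihomog_dE he) -pihomogB.
    exact: (ideal_pihomog (ker_kill K (outside (V l)))).
  + move=> t e [he [Pe ke]]; rewrite addn0 => -[_ Pl]; split; first exact: he.
    split=> [|q]; first exact: Pe.
    rewrite ltnS leq_eqVlt => /orP[/eqP eq_qm|/ke//].
    by have -> : q = l by apply: val_inj.
  (* S / P_l has bound 0 and S modulo the kernel has bound 1, so the kernel modulo P_l has bound
     2. *)
  + apply: (@kreg_sub _ _ _ _ _ _ (gpart (fun=> True)) _ gI); rewrite ?addn0.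
    * by move=> t e [he /sPI].
    * by move=> t e [he _].
    * exact: (kreg_leq (leq0n 2) (@kreg_kill K _ (outside (V l)))).
    * exact: kreg_phi.
- by apply: IHm; apply: ltnW.
Qed.

Lemma kreg_J : kregS (gpart (fun f => f \in J)) 2.
Proof.
refine (kreg_iff _ (kreg_Jpartial (leqnn r))) => t e.
split=> -[he]; first by case=> Pe ke; split=> //; apply/JP; split=> // l; exact: ke.
by move/JP=> [Pe ke]; split=> //; split=> // l _; exact: ke.
Qed.

Lemma J_homog : homog_ideal (fun f => f \in J).
Proof.
split=> [|d p /JP[Pp kp]]; first exact: J_ideal.
apply/JP; split; first exact: (ideal_pihomog (ker_phi K setT)).
by move=> l; apply: (ideal_pihomog (ker_kill K (outside (V l)))).
Qed.

(** * The v-number: which colon ideals of J are prime *)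

Lemma phi_var k : phi setT 'X_k != 0 :> {mpoly {poly K}[n]}.
Proof.
elim/vertexP: k => i; rewrite -/(x_ i) -/(y_ i) ?phi_x ?phi_y inE; last exact: mpolyXU_neq0.
by rewrite mulf_eq0 mpolyC_eq0 polyX_eq0 (negPf (mpolyXU_neq0 _ _)).
Qed.

Lemma bin_neq0 i j : i != j -> bin i j != 0.
Proof.
move=> ne_ij; apply/eqP => /(congr1 (kill [set lshift n i])).
rewrite rmorphB !rmorphM /= !killX !inE !eq_rlshift !eq_lshift eqxx.
rewrite [j == i]eq_sym (negPf ne_ij) mul0r raddf0 sub0r => /eqP.
by rewrite oppr_eq0 mulf_eq0 !(negPf (mpolyXU_neq0 _ _)).
Qed.

(** For k in another part, [x_ k * bin i j] lies in J. But [x_ k] is not in J : f, by [phi], and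
    [bin i j] is not, by restriction to V_l. *)
Lemma colon_not_prime (f : S) (P : {pred S}) l :
  colon J f =i P -> (2 <= r)%N -> (forall m, V m != set0) -> (1 < #|V l|)%N ->
  phi setT f != 0 -> killV l f != 0 -> ~ prime_ideal P.
Proof.
move=> eP r2 V0 /card_gt1P[i [j [Vi Vj ne_ij]]] nz_phf nz_kf [_ primeP].
have [m ne_ml] : exists m, m != l.
  have lt0r : (0 < r)%N by apply: leq_trans r2.
  have [->|ne] := eqVneq l (Ordinal lt0r); first by exists (Ordinal r2).
  by exists (Ordinal lt0r); rewrite eq_sym.
have [k Vk] := set0Pn _ (V0 m).
have notVk : k \notin V l by apply: contraNN ne_ml => Vk'; apply/eqP; exact: Vdisj Vk Vk'.
have: x_ k * bin i j \in P.
  rewrite -eP /in_mem /= /colon mulrC; apply: (idealM J_ideal).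
  by apply: (var_bin Vi Vj); rewrite vertexl.
move/primeP => /orP[]; rewrite -eP /in_mem /= /colon => /JP[].
  move=> /eqP; rewrite rmorphM mulf_eq0 /= (negPf nz_phf) orbF => ph_x _.
  by have := phi_var (lshift n k); rewrite ph_x.
move=> _ /(_ l) /eqP; rewrite rmorphM mulf_eq0 /= (negPf nz_kf) orbF.
by rewrite kill_outside_bin Vi Vj /= (negPf (bin_neq0 ne_ij)).
Qed.

(** The kernel of a map to a domain is prime; f itself shows that it is associated. *)
Lemma v_attained_ker (D : idomainType) (h : {rmorphism S -> D}) d (f : S) :
  f \is d.-homog -> (forall g, g * f \in J <-> h g = 0) -> v_attained J d.
Proof.
move=> hf colE; have cP g : g \in colon J f <-> h g = 0 by exact: colE.
exists f, (colon J f); split=> //; split; last by exists f.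
split; first split.
- by apply/cP; rewrite raddf0.
- by apply/negP => /cP/eqP; rewrite rmorph1 oner_eq0.
- by move=> a u v /cP hu /cP hv; apply/cP; rewrite rmorphD rmorphM /= hu hv mulr0 addr0.
- move=> u v /cP/eqP; rewrite rmorphM mulf_eq0 => /orP[] /eqP h0; apply/orP; [left|right];
    exact/cP.
Qed.

(** [x_ v] restricts to zero on the other parts, and a part with one vertex has no nonzero minors,
    so J_K is contained in P_l. *)
Lemma v_attained_singleton l v : V l = [set v] -> v_attained J 1.
Proof.
move=> Vl; apply: (v_attained_ker (h := phi setT) (dhomog_x K v)) => g; split.
  by case/JP => /eqP + _; rewrite rmorphM mulf_eq0 (negPf (phi_var _)) orbF => /eqP.
move=> phg; apply/JP; split=> [|m]; first by rewrite rmorphM /= phg mul0r.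
have [->|ne_ml] := eqVneq m l; last first.
  rewrite rmorphM /= kill_outside_x ifN ?mulr0 //.
  by apply: contraNN ne_ml => Vv; apply/eqP; apply: Vdisj Vv _; rewrite Vl inE.
rewrite rmorphM /=; suff -> : killV l g = 0 by rewrite mul0r.
have /ker_phiP := phi_subset (subsetT (V l)) phg.
apply: (@ideal_span_min _ _ _ (fun p => killV l p = 0)); first exact: homog_idealW (ker_kill _ _).
move=> _ [[i [j [+ + ->]]]|[k Tk ->]]; last by rewrite killX Tk.
by rewrite Vl !inE => /eqP -> /eqP ->; rewrite /edge_binomial subrr raddf0.
Qed.

(** [bin i j] lies in J_K and in every P_m with m other than l, so only P_l constrains the
    multiplier. *)
Lemma v_attained_bin l : (1 < #|V l|)%N -> v_attained J 2.
Proof.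
case/card_gt1P => [i [j [Vi Vj ne_ij]]].
apply: (v_attained_ker (h := killV l) (dhomog_bin K i j)) => g; split.
  case/JP => _ /(_ l) /eqP; rewrite rmorphM mulf_eq0 /= kill_outside_bin Vi Vj /=.
  by rewrite (negPf (bin_neq0 ne_ij)) orbF => /eqP.
move=> kg0; apply/JP; split=> [|m].
  by rewrite rmorphM /= phi_bin ?inE // mulr0.
rewrite rmorphM /= kill_outside_bin; case: ifP => [/andP[Vmi _]|_]; last by rewrite mulr0.
by rewrite (Vdisj Vmi Vi) kg0 mul0r.
Qed.

Lemma attained_neq0 (f : S) (P : {pred S}) : prime_ideal P -> colon J f =i P -> f != 0.
Proof.
case=> [[_ notP1 _] _] eP; apply: contraNneq notP1 => f0.
by rewrite -eP /in_mem /= /colon f0 mulr0; apply: (ideal0 J_ideal).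
Qed.

(** The kernel of [phi setT] is generated by quadrics. *)
Lemma phi_linear_neq0 (f : S) : f \is 1.-homog -> f != 0 -> phi setT f != 0.
Proof.
move=> hf; apply: contraNneq => /ker_phiP Gf; rewrite -(pihomog_dE hf); apply/eqP.
elim: Gf {hf} => [|c x p Xx _ IHp]; first exact: pihomog0.
rewrite pihomogD IHp addr0; case: Xx => [[i [j [_ _ ->]]]|[k]]; last by rewrite !inE.
exact: (piH_mulr_lt c (dhomog_bin K i j)).
Qed.

Lemma linear_sum_kill (f : S) : f \is 1.-homog -> f = \sum_l killV l f.
Proof.
move/dhomogP => hf; rewrite {1}(mpolyE f) [in RHS](mpolyE f).
under [RHS]eq_bigr => l _ do rewrite raddf_sum.
rewrite exchange_big /= big_seq [RHS]big_seq; apply: eq_bigr => m /hf /eqP.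
rewrite /= mdeg_eq1 => /existsP[k /eqP ->]; have [l Vk] := Vcover (vertex k).
rewrite (bigD1 l) //= big1 ?addr0 => [|q ne_ql]; rewrite -mul_mpolyC rmorphM /= killC killX inE.
  by rewrite Vk.
rewrite ifT ?mulr0 //; apply: contraNN ne_ql => Vqk.
by rewrite (Vdisj Vqk Vk).
Qed.

(** A nonzero constant survives all the maps of [JP], so [colon_not_prime] applies. *)
Lemma v_attained_ge1 l d : (2 <= r)%N -> (forall m, V m != set0) -> (1 < #|V l|)%N ->
  v_attained J d -> (1 <= d)%N.
Proof.
move=> r2 V0 Vl; case: d => // -[f [P [hf [primeP _] eP]]].
have nz_c : f@_0%MM != 0.
  have := attained_neq0 primeP eP; apply: contraNneq => c0.
  by rewrite (dhomog0E hf) c0 mpolyC0.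
case: (colon_not_prime eP r2 V0 Vl) => //; rewrite (dhomog0E hf).
  by rewrite phiC mpolyC_eq0 polyC_eq0.
by rewrite killC mpolyC_eq0.
Qed.

(** A nonzero linear form is outside J_K and has a nonzero restriction to some part, so
    [colon_not_prime] excludes degree 1. *)
Lemma v_attained_ge2 d : (2 <= r)%N -> (forall m, (1 < #|V m|)%N) ->
  v_attained J d -> (2 <= d)%N.
Proof.
move=> r2 V2 vJ; have V0 m : V m != set0 by rewrite -card_gt0 ltnW.
have := v_attained_ge1 r2 V0 (V2 (Ordinal r2)) vJ; case: d vJ => [|[|d]] // vJ _.
case: vJ => f [P [hf [primeP _] eP]]; have nz_f := attained_neq0 primeP eP.
have [l nz_kf] : exists l, killV l f != 0.
  apply/existsP; apply: contra_neqT nz_f => /existsPn all0.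
  by rewrite (linear_sum_kill hf) big1 // => l _; apply/eqP; rewrite -[_ == _]negbK.
by case: (colon_not_prime eP r2 V0 (V2 l)) => //; apply: phi_linear_neq0.
Qed.

(** * The 2-jets of elements of J and the syzygy of degree 4 *)

Local Notation xi := (@lshift n n).
Local Notation yi := (@rshift n n).

(** Linear conditions on the 2-jet at the origin that hold for combinations of the [bin i j] over
    edges. *)
Record quadratic_jet (g : S) : Prop := QuadraticJet {
  jet0 : der0 g = 0;
  jet1 : forall a, der1 a g = 0;
  jet_xx : forall i j, der2 (xi i) (xi j) g = 0;
  jet_yy : forall i j, der2 (yi i) (yi j) g = 0;
  jet_anti : forall i j, der2 (xi i) (yi j) g = - der2 (xi j) (yi i) g;
  jet_edge : forall i j, ~~ edge i j -> der2 (xi i) (yi j) g = 0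
}.

Lemma der2_bin a b i j : der2 a b (bin i j) =
  (xi i == a)%:R * (yi j == b)%:R + (xi i == b)%:R * (yi j == a)%:R
  - ((xi j == a)%:R * (yi i == b)%:R + (xi j == b)%:R * (yi i == a)%:R).
Proof. by rewrite raddfB /= !der2XX. Qed.

Lemma bin_jet i j : edge i j -> quadratic_jet (bin i j).
Proof.
move=> eij; split=> [|a|p q|p q|p q|p q notpq]; rewrite ?der2_bin.
- by rewrite raddfB /= !der0M !der0X !mul0r subr0.
- by rewrite raddfB /= !der1M !der0X !mul0r !mulr0 !addr0 subr0.
- by rewrite !eq_rlshift !mulr0 addr0 subr0.
- by rewrite !eq_lrshift !mul0r addr0 subr0.
- by rewrite !eq_lshift !eq_rshift !eq_lrshift !mul0r !addr0 opprB; congr (_ - _); exact: mulrC.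
- rewrite !eq_lshift !eq_rshift !eq_lrshift !mul0r !addr0.
  case: eqP => [ip|_]; case: eqP => [jq|_]; case: eqP => [jp|_]; case: eqP => [iq|_];
    rewrite ?mulr0 ?mul0r ?subr0 //.
  + by move: (edge_neq eij); rewrite ip -jp eqxx.
  + by rewrite -ip -jq eij in notpq.
  + by rewrite -ip -jq eij in notpq.
  + by rewrite -ip -jq eij in notpq.
  + by rewrite -jp -iq (edge_sym eij) in notpq.
  + by rewrite -jp -iq (edge_sym eij) in notpq.
  + by rewrite -jp -iq (edge_sym eij) in notpq.
Qed.

(** Lower jets being zero, only the constant term of a multiplier enters the 2-jet of a multiple. *)
Lemma J_jet g : g \in J -> quadratic_jet g.
Proof.
apply: J_min => [|i j]; last exact: bin_jet.
have e0 a b : der2 a b (0 : S) = 0 by exact: raddf0.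
have eB a b u v : der2 a b (u - v : S) = der2 a b u - der2 a b v by exact: raddfB.
have eM a b c u : der0 u = 0 -> (forall d, der1 d u = 0) ->
    der2 a b (c * u : S) = der0 c * der2 a b u.
  by move=> u0 u1; rewrite der2M u0 !u1 !mulr0 !add0r.
split=> [|u v [u0 u1 uxx uyy ua ue] [v0 v1 vxx vyy va ve]|c u [u0 u1 uxx uyy ua ue]].
- by split=> *; rewrite ?e0 ?oppr0 //; exact: raddf0.
- split=> [|a|p q|p q|p q|p q npq]; rewrite ?eB.
  + by rewrite raddfB /= u0 v0 subr0.
  + by rewrite raddfB /= u1 v1 subr0.
  + by rewrite uxx vxx subr0.
  + by rewrite uyy vyy subr0.
  + by rewrite ua va opprB opprK addrC.
  + by rewrite ue // ve // subr0.
- split=> [|a|p q|p q|p q|p q npq]; rewrite ?eM //.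
  + by rewrite der0M u0 mulr0.
  + by rewrite der1M u0 u1 !mulr0 addr0.
  + by rewrite uxx mulr0.
  + by rewrite uyy mulr0.
  + by rewrite ua mulrN.
  + by rewrite ue // mulr0.
Qed.

(* The Koszul syzygy of the disjoint edges ik and jm of the 4-cycle i k j m is not
   a combination of linear syzygies. *)
Lemma resolution_shift4 F i j k m l q : l != q ->
    i \in V l -> j \in V l -> k \in V q -> m \in V q -> i != j ->
    minimal_graded_resolution J F -> bijective (@augm_map K (n + n) F) ->
  exists2 s, s \in shifts F 2 & (3 < s)%N.
Proof.
move=> ne_lq Vi Vj Vk Vm ne_ij resF bijF.
apply: contrapT => no4.
have le3 s : s \in shifts F 2 -> (s <= 3)%N.
  by move=> s_in; rewrite leqNgt; apply/negP => lt3; apply: no4; exists s.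
(* The images in S of the basis vectors of F_1; they generate J. *)
pose G b : S := augm_map (row b (diff F 0)).
have augm_sum (w : 'rV[S]_(size (shifts F 1))) : augm_map (w *m diff F 0) = \sum_b w 0 b * G b.
  rewrite /augm_map -mulmxA mxE; apply: eq_bigr => b _.
  by rewrite /G /augm_map -row_mul [in RHS]mxE.
have augm_inj : injective (@augm_map K (n + n) F) by exact: bij_inj.
have augm0 : @augm_map K (n + n) F 0 = 0 by rewrite /augm_map mul0mx mxE.
have JG b : G b \in J.
  by apply/(exact_augm resF); exists (delta_mx 0 b); rewrite rowE.
have jG b := J_jet (JG b).
have genJ g : g \in J -> exists w : 'rV[S]_(size (shifts F 1)), g = \sum_b w 0 b * G b.
  have [inv _ augmK] := bijF; rewrite -[g]augmK => /(exact_augm resF)[w ->].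
  by exists w; rewrite augm_sum.
have degG b mm : mm \in msupp (G b) -> mdeg mm = nth 0%N (shifts F 1) b.
  rewrite /G /augm_map -row_mul mxE mxE.
  elim/big_ind: _ => [|p1 p2 IH1 IH2|a _]; first by rewrite msupp0.
    by move/msuppD_le; rewrite mem_cat => /orP[/IH1|/IH2].
  case/msuppM_le/allpairsP => -[m1 m2] /= [/(diff_graded resF) <- /(augm_graded resF) <- ->].
  by rewrite mdegD add0n addnC.
(* The coefficient of x_i y_k in [G b]. *)
pose gam b := der2 (xi i) (yi k) (G b).
pose D c b := diff F 1 c b.
have D0 c b : der0 (D c b) = 0 by exact: (diff_minimal resF).
have DG c : \sum_b D c b * G b = 0.
  have /(exact_diff resF) d0 : exists w, row c (diff F 1) = w *m diff F 1.
    by exists (delta_mx 0 c); rewrite rowE.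
  have := augm_sum (row c (diff F 1)); rewrite d0 augm0 => e0; apply: etrans (esym e0).
  by apply: eq_bigr => b _; rewrite mxE.
(* If [gam b] is nonzero, generator b has degree 2, and shifts at most 3 leave [D c b] of degree at
   most 1. *)
have D2 c b a1 a2 : gam b * der2 a1 a2 (D c b) = 0.
  have [def2|ne2] := eqVneq (nth 0%N (shifts F 1) b) 2%N; last first.
    by rewrite /gam der2_deg ?mul0r // => mm /degG ->.
  rewrite [der2 _ _ (D c b)]der2_deg ?mulr0 // => mm /(diff_graded resF) def3.
  have /le3 : nth 0%N (shifts F 2) c \in shifts F 2 by apply: mem_nth.
  by rewrite -def3 def2; case: (mdeg mm) => [|[|[|]]].
have rel c a1 a2 a3 : \sum_b (der1 a1 (D c b) * der2 a2 a3 (G b)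
    + der1 a2 (D c b) * der2 a1 a3 (G b) + der1 a3 (D c b) * der2 a1 a2 (G b)) = 0.
  have e0 : \sum_b der3 a1 a2 a3 (D c b * G b) = 0.
    by have := congr1 (der3 a1 a2 a3) (DG c); rewrite raddf0 raddf_sum.
  apply: etrans e0.
  by apply: eq_bigr => b _; rewrite der3M //; case: (jG b).
have notij : ~~ edge i j by rewrite (edgeE _ Vi) Vj.
have notmk : ~~ edge m k by rewrite (edgeE _ Vm) Vk.
(* At x_i x_k y_j the nonedge and xx terms vanish, so antisymmetry gives [rel1]; the relation at x_j
   x_i y_k then leaves the desired sum. *)
have linj c : \sum_b gam b * der1 (xi j) (D c b) = 0.
  have rel1 : \sum_b der1 (xi i) (D c b) * der2 (xi j) (yi k) (G b) = 0.
    apply: oppr_inj; rewrite oppr0 -sumrN; apply: etrans (rel c (xi i) (xi k) (yi j)).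
    apply: eq_bigr => b _; have [_ _ xx _ anti nedge] := jG b.
    by rewrite (nedge i j) // xx !mulr0 !addr0 anti mulrN ?opprK.
  apply: etrans (rel c (xi j) (xi i) (yi k)); rewrite !big_split /= rel1 addr0.
  rewrite [X in _ = _ + X]big1 ?addr0 => [|b _]; last by rewrite (jet_xx (jG b)) mulr0.
  by apply: eq_bigr => b _; rewrite mulrC.
(* The same with x and y exchanged, for the nonedge mk: relations at x_m y_i y_k and y_m x_i y_k. *)
have linm c : \sum_b gam b * der1 (yi m) (D c b) = 0.
  have rel1 : \sum_b der1 (yi k) (D c b) * der2 (yi m) (xi i) (G b) = 0.
    apply: oppr_inj; rewrite oppr0 -sumrN; apply: etrans (rel c (xi m) (yi i) (yi k)).
    apply: eq_bigr => b _; have [_ _ _ yy anti nedge] := jG b.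
    by rewrite (nedge m k) // yy !mulr0 !add0r der2C anti mulrN opprK.
  apply: etrans (rel c (yi m) (xi i) (yi k)); rewrite !big_split /= rel1 addr0.
  rewrite [X in _ = _ + X]big1 ?addr0 => [|b _]; last by rewrite (jet_yy (jG b)) mulr0.
  by apply: eq_bigr => b _; rewrite mulrC.
have eik : edge i k.
  by rewrite (edgeE _ Vi); apply: contraNN ne_lq => Vk'; apply/eqP; exact: Vdisj Vk' Vk.
have ejm : edge j m.
  by rewrite (edgeE _ Vj); apply: contraNN ne_lq => Vm'; apply/eqP; exact: Vdisj Vm' Vm.
have [u def_ik] := genJ _ (bin_edge eik).
have [u' def_jm] := genJ _ (bin_edge ejm).
(* The Koszul syzygy, written in F_1 through lifts of the two binomials. *)
pose v := bin j m *: u - bin i k *: u'.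
have [w def_v] : exists w, v = w *m diff F 1.
  apply/(exact_diff resF); apply: augm_inj; rewrite augm0 augm_sum.
  rewrite (eq_bigr (fun b => bin j m * (u 0 b * G b) - bin i k * (u' 0 b * G b))) => [|b _].
    by rewrite sumrB -!mulr_sumr -def_ik -def_jm mulrC subrr.
  by rewrite !mxE mulrBl !mulrA.
(* By [Lgen] below, the constant term of [L z] is the coefficient of x_i y_k in the image of z in
   J. *)
pose L (z : 'rV[S]_(size (shifts F 1))) := \sum_b (gam b)%:MP * z 0 b.
have der_gam b (p : S) : der0 ((gam b)%:MP * p) = gam b * der0 p by rewrite /der0 mcoeffCM.
have Lrow c : [/\ der0 (L (row c (diff F 1))) = 0, der1 (xi j) (L (row c (diff F 1))) = 0,
    der1 (yi m) (L (row c (diff F 1))) = 0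
    & der2 (xi j) (yi m) (L (row c (diff F 1))) = 0].
  have mC b (p : S) : (gam b)%:MP * p = gam b *: p by rewrite mul_mpolyC.
  rewrite /L; under eq_bigr => b _ do rewrite mC mxE.
  split; rewrite raddf_sum /=.
  - by rewrite big1 // => b _; rewrite der0Z D0 mulr0.
  - by apply: etrans (linj c); apply: eq_bigr => b _; rewrite der1Z.
  - by apply: etrans (linm c); apply: eq_bigr => b _; rewrite der1Z.
  - by rewrite big1 // => b _; rewrite der2Z.
(* [v] is a combination of rows of the differential, on which [L] has no constant, x_j, y_m or x_j
   y_m term. *)
have Lv0 : der2 (xi j) (yi m) (L v) = 0.
  have -> : L v = \sum_c w 0 c * L (row c (diff F 1)).
    rewrite /L; under [RHS]eq_bigr => c _ do rewrite mulr_sumr.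
    rewrite exchange_big; apply: eq_bigr => b _ /=; rewrite def_v mxE mulr_sumr.
    by apply: eq_bigr => c _; rewrite mxE mulrCA.
  rewrite raddf_sum big1 // => c _ /=; have [L0 L1 L2 L3] := Lrow c.
  by rewrite der2M L0 L1 L2 L3 !mulr0 !addr0.
have Lgen (z : 'rV[S]_(size (shifts F 1))) :
    der0 (L z) = der2 (xi i) (yi k) (\sum_b z 0 b * G b).
  rewrite !raddf_sum; apply: eq_bigr => b _ /=; rewrite der_gam.
  by have [G0 G1 _ _ _ _] := jG b; rewrite der2M G0 !G1 !mulr0 !add0r mulrC.
have jbin p q' : edge p q' -> quadratic_jet (bin p q') by exact: bin_jet.
have [ik0 ik1 _ _ _ _] := jbin _ _ eik; have [jm0 jm1 _ _ _ _] := jbin _ _ ejm.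
(* Contradiction: [L u] has constant term 1, so [bin j m * L u] contributes x_j y_m, which does not
   occur in [bin i k]. *)
have: der2 (xi j) (yi m) (L v) = 1.
  have -> : L v = bin j m * L u - bin i k * L u'.
    rewrite /L !mulr_sumr -sumrB; apply: eq_bigr => b _.
    by rewrite !mxE mulrBr !(mulrCA (gam b)%:MP).
  rewrite raddfB /= !der2M ik0 jm0 !ik1 !jm1 !mul0r !addr0 !Lgen -def_ik -def_jm !der2_bin.
  have cross p p' : p \in V l -> p' \in V q -> (p == p') = false.
    move=> Vp Vp'; apply: contraNF ne_lq => /eqP pp'; apply/eqP.
    by apply: Vdisj Vp _; rewrite pp'.
  rewrite !eq_lshift !eq_rshift !eq_lrshift !eqxx (negPf ne_ij).
  rewrite [m == j]eq_sym [k == i]eq_sym [m == i]eq_sym.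
  rewrite (cross _ _ Vj Vm) (cross _ _ Vi Vk) (cross _ _ Vi Vm).
  by rewrite -![false%:R]/(0 : K) -![true%:R]/(1 : K) !(mul0r, mulr0, addr0, subr0, mulr1).
by rewrite Lv0 => /esym/eqP; rewrite oner_eq0.
Qed.

Lemma regularity_J : (2 <= r)%N -> (forall l, (1 < #|V l|)%N) -> is_regularity J 2%:Z.
Proof.
move=> r2 V2; pose l := Ordinal (ltnW r2); pose q := Ordinal r2.
have /card_gt1P[i [j [Vi Vj ne_ij]]] := V2 l.
have /card_gt1P[k [m [Vk Vm _]]] := V2 q.
have J0 f : f \in J -> f@_0%MM = 0 by move/J_jet/jet0.
have [F [resF bijF leF]] := resolution_exists J_homog J0 (@kreg_J).
exists (fun i j => count_mem j (shifts F i)); split.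
- by exists F.
- have [s F2s lt3s] := resolution_shift4 (isT : l != q) Vi Vj Vk Vm ne_ij resF bijF.
  (* The shift exceeds 3 and is at most 2 + 2. *)
  exists 2%N, 4%N; split=> //; have /eqP def_s : s == 4 by rewrite eqn_leq lt3s (leF _ _ F2s).
  by rewrite def_s in F2s; apply/eqP; rewrite -lt0n -has_count has_pred1.
- move=> a b /eqP; rewrite -lt0n -has_count has_pred1 => /leF le_ba.
  by rewrite Num.Theory.lerBlDl -PoszD lez_nat.
Qed.

End Multipartite.

(* From the sorted sizes to the parts, and the two cases *)
Local Close Scope ring_scope.

Theorem proposition4p2 (K : fieldType) (n r : nat) (a : r.-tuple nat)
    (V : 'I_r -> {set 'I_n})
    (r_ge2 : 1 < r)
    (a_sorted : sorted leq a)
    (a1_gt0 : 0 < head 0 a)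
    (not_complete : 1 < last 0 a)
    (V_parts : part_sizes V a) :
  let J := binomial_edge_ideal (K := K) (multipartite_rel V) in
  if head 0 a == 1 then is_vnumber J 1
  else is_vnumber J 2 /\ is_regularity J 2%:Z.
Proof.
move=> J; have [coverV disjV cardV] := V_parts.
have Vcover i : exists l, i \in V l.
  by have : i \in \bigcup_l V l; [rewrite coverV inE | case/bigcupP => l _; exists l].
have Vdisj i l m : i \in V l -> i \in V m -> l = m.
  move=> Vi Vi'; apply: contraTeq Vi' => /disjV dis_lm.
  by rewrite (disjointFr dis_lm Vi).
have card_first : #|V (Ordinal (ltnW r_ge2))| = head 0 a.
  by rewrite cardV (tnth_nth 0) nth0.
have min_card l : head 0 a <= #|V l|.
  rewrite cardV (tnth_nth 0) -nth0.
  by apply: (sorted_leq_nth leq_trans leqnn) => //; rewrite inE size_tuple ?ltn_ord // ltnW.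
have V0 l : V l != set0 by rewrite -card_gt0 (leq_trans a1_gt0).
case: eqP => [a1_eq1|a1_neq1].
  have [v Vv] : exists v, V (Ordinal (ltnW r_ge2)) = [set v].
    by apply/cards1P; rewrite card_first a1_eq1.
  split; first exact: v_attained_singleton Vv.
  (* The last part has at least two vertices by [not_complete], as the lower bound requires. *)
  have lt_r : r.-1 < r by rewrite prednK // ltnW.
  have last_gt1 : 1 < #|V (Ordinal lt_r)|.
    by rewrite cardV (tnth_nth 0) /= -{2}(size_tuple a) nth_last.
  by move=> d; exact: v_attained_ge1 last_gt1.
have V2 l : 1 < #|V l|.
  apply: leq_trans (min_card l); rewrite ltn_neqAle a1_gt0 andbT eq_sym; exact/eqP.
split; last exact: regularity_J.
split; first exact: v_attained_bin (V2 (Ordinal r_ge2)).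
by move=> d; exact: v_attained_ge2.
Qed.
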